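(* Let $G$ be a finitely generated virtually free group and let $K\subseteq G$. The following are equivalent: (1) $K$ is a rational subset of $G$; (2) $\mathrm{Geo}_X(K)$ is a rational language for some finite generating set $X$ of $G$; (3) $\mathrm{Geo}_X(K)$ is a rational language for every finite generating set $X$ of $G$. Moreover, the constructions are effective: from a finite automaton witnessing one of these conditions one can compute finite automata witnessing the others.
   Context: A group is virtually free if it has a free subgroup of finite index. For a finite generating set $X$ of $G$, let $\widetilde X=X\cup X^{-1}$ and let $\pi_X:\widetilde X^*\to G$ be the canonical surjective monoid homomorphism. A subset $K\subseteq G$ is rational if $K=L\pi_X$ for some rational (regular) language $L\subseteq\widetilde X^*$ (this does not depend on the finite generating set $X$). $\mathrm{Geo}_X(K)\subseteq\widetilde X^*$ is the language of all geodesic words over $\widetilde X$ (words of minimal length among all words over $\widetilde X$ representing the same group element) that represent elements of $K$. *)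

(* Defs.v *)
From mathcomp Require Import all_boot.

Set Implicit Arguments.
Unset Strict Implicit.
Unset Printing Implicit Defensive.

Local Open Scope group_scope.

(** * Words over a finite subset of a group *)

Section Words.
Variable G : groupType.
Implicit Types (X : seq G) (K : G -> Prop) (w : seq G).

(* A finite subset X of G is given by a list; the alphabet X u X^-1 is a
   subset of G, so a word over it is a list of elements of G. *)
Definition symm X : seq G := X ++ [seq x^-1 | x <- X].

Definition word_over X w : bool := all [in symm X] w.

Definition word_val w : G := \prod_(x <- w) x.

Definition generating X : Prop :=
  forall g, exists2 w, word_over X w & word_val w = g.

Definition finitely_generated : Prop := exists X, generating X.

Definition geodesic X w : Prop :=
  word_over X w /\
  forall v, word_over X v -> word_val v = word_val w -> size w <= size v.

Definition Geo X K (w : seq G) : Prop := geodesic X w /\ K (word_val w).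

End Words.

(** * Virtually free groups *)

Section VirtuallyFree.
Variable G : groupType.
Implicit Types (H B : G -> Prop).

Definition is_subgroup H : Prop :=
  H 1 /\ forall x y, H x -> H y -> H (x / y).

Definition finite_index H : Prop :=
  exists T : seq G, forall g, exists2 t, t \in T & H (g / t).

(* The letter (b, true) stands for b and (b, false) for the formal inverse of
   b, so an element of B and its inverse are different letters. *)
Definition sletter_val (u : G * bool) : G := if u.2 then u.1 else u.1^-1.

Definition reduced (w : seq (G * bool)) : bool :=
  sorted (fun u v => ~~ ((u.1 == v.1) && (u.2 != v.2))) w.

Definition free_basis B H : Prop :=
  (forall b, B b -> H b) /\
  forall h, H h -> exists! w : seq (G * bool),
    [/\ forall u, u \in w -> B u.1, reduced w
      & \prod_(u <- w) sletter_val u = h].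

Definition free_subgroup H : Prop :=
  is_subgroup H /\ exists B, free_basis B H.

Definition virtually_free : Prop :=
  exists H, free_subgroup H /\ finite_index H.

End VirtuallyFree.

(** * Finite automata and rational languages *)

(* ((I, F), E): initial states, final states and labelled edges (p, a, q) of a
   nondeterministic automaton. States are natural numbers; only the finitely
   many that occur in the three lists matter. *)
Definition nfa (A : Type) : Type :=
  ((seq nat * seq nat) * seq ((nat * A) * nat))%type.

Section Automata.
Variable A : eqType.

Fixpoint accepts_from (M : nfa A) (p : nat) (w : seq A) : Prop :=
  if w is a :: w' then
    exists2 q, (p, a, q) \in M.2 & accepts_from M q w'
  else p \in M.1.2.

Definition accepts (M : nfa A) (w : seq A) : Prop :=
  exists2 p, p \in M.1.1 & accepts_from M p w.

End Automata.

Definition map_nfa (A B : Type) (f : A -> B) (M : nfa A) : nfa B :=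
  (M.1, [seq ((e.1.1, f e.1.2), e.2) | e <- M.2]).

Section Rational.
Variable G : groupType.
Implicit Types (X : seq G) (K : G -> Prop) (M : nfa G) (L : seq G -> Prop).

Definition nfa_over X M : bool := all (fun e => e.1.2 \in symm X) M.2.

Definition recognizes X M L : Prop :=
  nfa_over X M /\ forall w, L w <-> accepts M w.

Definition rational_language X L : Prop := exists M, recognizes X M L.

Definition image_val L (g : G) : Prop := exists2 w, L w & word_val w = g.

Definition rational_subset K : Prop :=
  exists X, generating X /\
  exists2 L, rational_language X L & forall g, K g <-> image_val L g.

End Rational.

(** * Algorithms *)

(* Partial recursive functions on the data types built from the natural
   numbers by products and finite lists. *)

Inductive dtype : Type :=
  | Nat
  | Prod of dtype & dtype
  | List of dtype.

Fixpoint den (T : dtype) : Type :=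
  match T with
  | Nat => nat
  | Prod T1 T2 => (den T1 * den T2)%type
  | List T1 => seq (den T1)
  end.

Inductive prog : dtype -> dtype -> Type :=
  | PId S : prog S S
  | PComp S T U : prog T U -> prog S T -> prog S U
  | PPair S T U : prog S T -> prog S U -> prog S (Prod T U)
  | PFst S T : prog (Prod S T) S
  | PSnd S T : prog (Prod S T) T
  | PZero S : prog S Nat
  | PSucc : prog Nat Nat
  | PNil S T : prog S (List T)
  | PCons T : prog (Prod T (List T)) (List T)
  | PNatRec S T :
      prog S T -> prog (Prod S (Prod Nat T)) T -> prog (Prod S Nat) T
  | PListRec S A T :
      prog S T -> prog (Prod S (Prod A T)) T -> prog (Prod S (List A)) T
  | PMu S : prog (Prod S Nat) Nat -> prog S Nat.

(* Relational versions of iteri and foldr, for partial functions. *)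
Fixpoint nat_iter (T : Type) (base : T -> Prop) (step : nat -> T -> T -> Prop)
    (n : nat) (y : T) : Prop :=
  if n is m.+1 then exists2 r, nat_iter base step m r & step m r y
  else base y.

Fixpoint list_iter (A T : Type) (base : T -> Prop) (step : A -> T -> T -> Prop)
    (s : seq A) (y : T) : Prop :=
  if s is a :: s' then exists2 r, list_iter base step s' r & step a r y
  else base y.

(* runs p x y: on input x, the program p halts with output y. *)
Fixpoint runs (S T : dtype) (p : prog S T) : den S -> den T -> Prop :=
  match p in prog S0 T0 return den S0 -> den T0 -> Prop with
  | PId _ => fun x y => y = x
  | PComp _ _ _ q p => fun x z => exists2 y, runs p x y & runs q y z
  | PPair _ _ _ p q => fun x y => runs p x y.1 /\ runs q x y.2
  | PFst _ _ => fun x y => y = x.1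
  | PSnd _ _ => fun x y => y = x.2
  | PZero _ => fun _ y => y = 0%N
  | PSucc => fun x y => y = x.+1
  | PNil _ _ => fun _ y => y = [::]
  | PCons _ => fun x y => y = x.1 :: x.2
  | PNatRec _ _ f g => fun x y =>
      nat_iter (runs f x.1) (fun n r => runs g (x.1, (n, r))) x.2 y
  | PListRec _ _ _ f g => fun x y =>
      list_iter (runs f x.1) (fun a r => runs g (x.1, (a, r))) x.2 y
  | PMu _ f => fun x n =>
      runs f (x, n) 0%N /\ forall m, m < n -> exists k, runs f (x, m) k.+1
  end.

Lemma runs_det (S T : dtype) (p : prog S T) (x : den S) (y z : den T) :
  runs p x y -> runs p x z -> y = z.
Proof.
elim: p x y z => {S T} /=.
- by move=> S x y z -> ->.
- move=> S T U q IHq p IHp x y z [u pu qu] [v pv qv].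
  by rewrite (IHp _ _ _ pu pv) in qu; apply: IHq qu qv.
- move=> S T U p IHp q IHq x [y1 y2] [z1 z2] /= [a b] [c d].
  by rewrite (IHp _ _ _ a c) (IHq _ _ _ b d).
- by move=> S T x y z -> ->.
- by move=> S T x y z -> ->.
- by move=> S x y z -> ->.
- by move=> x y z -> ->.
- by move=> S T x y z -> ->.
- by move=> T x y z -> ->.
- move=> S T f IHf g IHg [x n] /=; elim: n => [|n IHn] y z /=.
    exact: IHf.
  by move=> [u nu gu] [v nv gv]; rewrite (IHn _ _ nu nv) in gu; apply: IHg gu gv.
- move=> S A T f IHf g IHg [x s] /=; elim: s => [|a s IHs] y z /=.
    exact: IHf.
  by move=> [u nu gu] [v nv gv]; rewrite (IHs _ _ nu nv) in gu; apply: IHg gu gv.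
move=> S f IHf x y z [fy ly] [fz lz].
case: (ltngtP y z) => // [/lz | /ly] [k fk].
  by have := IHf _ _ _ fk fy.
by have := IHf _ _ _ fk fz.
Qed.

(** * Effectiveness *)

(* Fix a finite generating list Z of G. A letter over an alphabet symm X is
   coded by its position in symm X; a finite subset of G is coded by a list of
   words over symm Z; an automaton over symm X is coded by replacing its
   labels by their codes. *)
Definition gensT : dtype := List (List Nat).

Definition nfaT : dtype :=
  Prod (Prod (List Nat) (List Nat)) (List (Prod (Prod Nat Nat) Nat)).

Section Effective.
Variable G : groupType.
Implicit Types (X Z : seq G) (K : G -> Prop).

Definition letter X (i : nat) : G := nth 1 (symm X) i.

Definition decode_gens Z (x : den gensT) : seq G :=
  [seq word_val [seq letter Z i | i <- w] | w <- x].

Definition decode_nfa X (M : den nfaT) : nfa G := map_nfa (letter X) M.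

Definition rational_witness X (M : nfa G) K : Prop :=
  nfa_over X M /\ forall g, K g <-> image_val (accepts M) g.

Definition geo_witness X (M : nfa G) K : Prop := recognizes X M (Geo X K).

(* One algorithm takes (the codes of) finite generating sets X and Y and an
   automaton over symm X that is a P-witness for some K, and returns an
   automaton over symm Y that is a Q-witness for the same K. Since Y is an
   input, this computes a whole family of Q-witnesses, one for each Y. *)
Definition effective Z (P Q : seq G -> nfa G -> (G -> Prop) -> Prop) : Prop :=
  exists F : prog (Prod gensT (Prod gensT nfaT)) nfaT,
  forall (x y : den gensT) (M : den nfaT) K,
    let X := decode_gens Z x in let Y := decode_gens Z y in
    generating X -> generating Y -> P X (decode_nfa X M) K ->
    exists2 N : den nfaT, runs F (x, (y, M)) N & Q Y (decode_nfa Y N) K.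

End Effective.

(* Main.v *)
(** Let H be a free subgroup of finite index and T a finite transversal with
    1 in T. Every g in G has a unique normal form h t with h a reduced word and
    t in T. Multiplying g by a generator changes h only near its end, so for
    every reduced word a, viewed as a vertex of the tree of reduced words, a
    path in the Cayley graph of G from an element whose normal form has prefix a
    to one whose normal form has not passes at bounded distance from a.

    Hence, if v is geodesic over Y and a(i) is the largest common prefix of the
    normal forms of all prefixes of v of length at least i, then the prefix v(i)
    of length i stays at bounded distance from a(i), and a(0), a(1), ... are
    increasing prefixes of the normal form of v. Turning an automaton for K into
    one that reads normal forms (Benois' saturation), one can follow v by a
    finite automaton that remembers a(i)^-1 v(i) and the state reached after
    a(i). Similarly, if all proper prefixes of v are geodesic but v is not, then
    a shorter word with the same value stays at bounded distance from v, so that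
    a subset construction recognizes the geodesics.

    All these bounds are computed from the maximal length over Y of the elements
    of a fixed finite set, which an unbounded search finds; the rest of the
    algorithm is primitive recursive. Conversely, an automaton for Geo_X(K) is
    already one for K, because every element has a geodesic, so a single
    algorithm serves in all directions. *)

Require Import Defs.
From mathcomp Require Import all_boot.
From mathcomp Require boolp.

Set Implicit Arguments.
Unset Strict Implicit.
Unset Printing Implicit Defensive.

(** * Computable functions *)

(* Data types that can be coded in [den T] for some [T : dtype] *)
Class rep (A : Type) := Rep { rty : dtype; enc : A -> den rty }.

#[local] Instance rep_nat : rep nat := @Rep nat Nat id.
#[local] Instance rep_bool : rep bool := @Rep bool Nat nat_of_bool.
#[local] Instance rep_prod A B {rA : rep A} {rB : rep B} : rep (A * B) :=
  @Rep (A * B) (Prod (rty (A := A)) (rty (A := B)))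
    (fun x => (enc x.1, enc x.2)).
#[local] Instance rep_seq A {rA : rep A} : rep (seq A) :=
  @Rep (seq A) (List (rty (A := A))) (map enc).

Definition computable {A B : Type} {rA : rep A} {rB : rep B} (f : A -> B) :=
  exists p : prog (rty (A := A)) (rty (A := B)),
    forall a, runs p (enc a) (enc (f a)).

Section Closure.
Context {A B C D : Type} {rA : rep A} {rB : rep B} {rC : rep C} {rD : rep D}.

Lemma computable_ext (f : A -> B) {g : A -> B} :
  computable f -> f =1 g -> computable g.
Proof. by move=> [p rp] fg; exists p => a; rewrite -fg. Qed.

Lemma computable_id : computable (fun a : A => a).
Proof. by exists (PId _). Qed.

Lemma computable_comp (g : B -> C) (f : A -> B) :
  computable g -> computable f -> computable (fun a => g (f a)).
Proof.
by move=> [q rq] [p rp]; exists (PComp q p) => a; exists (enc (f a)).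
Qed.

Lemma computable_pair (f : A -> B) (g : A -> C) :
  computable f -> computable g -> computable (fun a => (f a, g a)).
Proof. by move=> [p rp] [q rq]; exists (PPair p q). Qed.

Lemma computable_fst (f : A -> B * C) :
  computable f -> computable (fun a => (f a).1).
Proof.
by move=> [p rp]; exists (PComp (PFst _ _) p) => a; exists (enc (f a)).
Qed.

Lemma computable_snd (f : A -> B * C) :
  computable f -> computable (fun a => (f a).2).
Proof.
by move=> [p rp]; exists (PComp (PSnd _ _) p) => a; exists (enc (f a)).
Qed.

Lemma computable_cons (f : A -> B) (s : A -> seq B) :
  computable f -> computable s -> computable (fun a => f a :: s a).
Proof.
move=> [p rp] [q rq]; exists (PComp (PCons _) (PPair p q)) => a.
by exists (enc (f a), enc (s a)).
Qed.

Lemma computable_succn (f : A -> nat) :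
  computable f -> computable (fun a => (f a).+1).
Proof.
by move=> [p rp]; exists (PComp PSucc p) => a; exists (enc (f a)).
Qed.

(** Finite data attached to the group, such as the Schreier table, can thus enter a program as
    constants. *)
Lemma runs_const (S T : dtype) (y : den T) :
  exists p : prog S T, forall x, runs p x y.
Proof.
elim: T y => [|T IHT U IHU|T IHT] /=.
- elim=> [|n [p rp]]; first by exists (PZero _).
  by exists (PComp PSucc p) => x; exists n.
- move=> [y z]; have [[p rp] [q rq]] := (IHT y, IHU z).
  by exists (PPair p q).
elim=> [|y s [q rq]]; first by exists (PNil _ _).
have [p rp] := IHT y.
by exists (PComp (PCons _) (PPair p q)) => x; exists (y, s).
Qed.

Lemma computable_const (b : B) : computable (fun _ : A => b).
Proof. by have [p rp] := runs_const (rty (A := A)) (enc b); exists p. Qed.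

Lemma computable_iteri (n : A -> nat) (F : A -> nat -> B -> B) (x : A -> B) :
  computable n ->
  computable (fun c : A * (nat * B) => F c.1 c.2.1 c.2.2) ->
  computable x -> computable (fun a => iteri (n a) (F a) (x a)).
Proof.
move=> [pn rn] [pF rF] [px rx].
exists (PComp (PNatRec px pF) (PPair (PId _) pn)) => a.
exists (enc a, n a); first by split; [|exact: rn].
elim: (n a) => [|m IHm] /=; first exact: rx.
by exists (enc (iteri m (F a) (x a))) => //; apply: (rF (a, (m, _))).
Qed.

Lemma computable_foldr (F : A -> C -> B -> B) (x : A -> B) (s : A -> seq C) :
  computable (fun c : A * (C * B) => F c.1 c.2.1 c.2.2) ->
  computable x -> computable s -> computable (fun a => foldr (F a) (x a) (s a)).
Proof.
move=> [pF rF] [px rx] [ps rs].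
exists (PComp (PListRec px pF) (PPair (PId _) ps)) => a.
exists (enc a, enc (s a)); first by split; [|exact: rs].
elim: (s a) => [|c t IHt] /=; first exact: rx.
by exists (enc (foldr (F a) (x a) t)) => //; apply: (rF (a, (c, _))).
Qed.

Lemma computable_if (b : A -> bool) (f g : A -> B) :
  computable b -> computable f -> computable g ->
  computable (fun a => if b a then f a else g a).
Proof.
move=> [pb rb] [pf rf] [pg rg].
(* Recursion on the code 0 or 1 of the test: the base case runs [g], and the single step discards
   its result and runs [f]. *)
exists (PComp (PNatRec pg (PComp pf (PFst _ _))) (PPair (PId _) pb)) => a.
exists (enc a, nat_of_bool (b a)); first by split; [|exact: rb].
by case: (b a) => /=; [exists (enc (g a)); [|exists (enc a)]|].
Qed.

End Closure.

Arguments computable_ext {A B rA rB} f {g} _ _.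

(** The test is total, so minimization finds the least witness whenever there is one; on other
    inputs nothing is claimed. *)
Lemma computable_search (A : Type) (rA : rep A) (t : A * nat -> bool) :
  computable t -> exists p : prog (rty (A := A)) Nat, forall a,
    (exists n, t (a, n)) -> exists2 n : nat, t (a, n) & runs p (enc a) n.
Proof.
move=> ct; have [p rp] : computable (fun c => if t c then 0 else 1).
  by apply: computable_if => //; exact: computable_const.
exists (PMu p) => a ta; exists (ex_minn ta); case: ex_minnP => // n tn minn /=.
split=> [|m lt_mn]; first by move: (rp (a, n)); rewrite tn.
exists 0; move: (rp (a, m)); case: ifP => // /minn.
by rewrite leqNgt lt_mn.
Qed.

(** * Deriving computability from the shape of a term *)

Class computable1 {A B} {rA : rep A} {rB : rep B} (f : A -> B) :=
  is_computable1 : computable f.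
Class computable2 {A B C} {rA : rep A} {rB : rep B} {rC : rep C}
  (f : A -> B -> C) := is_computable2 : computable (fun c : A * B => f c.1 c.2).
Class computable3 {A B C D} {rA : rep A} {rB : rep B} {rC : rep C} {rD : rep D}
    (f : A -> B -> C -> D) :=
  is_computable3 : computable (fun c : A * B * C => f c.1.1 c.1.2 c.2).
Class computable4 {A B C D E} {rA : rep A} {rB : rep B} {rC : rep C}
    {rD : rep D} {rE : rep E} (f : A -> B -> C -> D -> E) :=
  is_computable4 :
    computable (fun c : A * B * C * D => f c.1.1.1 c.1.1.2 c.1.2 c.2).

Section Apply.
Context {A B C D E X : Type} {rA : rep A} {rB : rep B} {rC : rep C}
  {rD : rep D} {rE : rep E} {rX : rep X}.

Lemma computable_app1 (f : A -> B) {cf : computable1 f} (a : X -> A) :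
  computable a -> computable (fun x => f (a x)).
Proof. exact: computable_comp. Qed.

Lemma computable_app2 (f : A -> B -> C) {cf : computable2 f} a b :
  computable a -> computable b -> computable (fun x : X => f (a x) (b x)).
Proof.
by move=> ca cb; exact: (computable_comp cf (computable_pair ca cb)).
Qed.

Lemma computable_app3 (f : A -> B -> C -> D) {cf : computable3 f} a b c :
  computable a -> computable b -> computable c ->
  computable (fun x : X => f (a x) (b x) (c x)).
Proof.
move=> ca cb cc.
exact: (computable_comp cf (computable_pair (computable_pair ca cb) cc)).
Qed.

Lemma computable_app4 (f : A -> B -> C -> D -> E) {cf : computable4 f} a b c d :
  computable a -> computable b -> computable c -> computable d ->
  computable (fun x : X => f (a x) (b x) (c x) (d x)).
Proof.
move=> ca cb cc cd.
exact: (computable_comp cf (computable_pair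
  (computable_pair (computable_pair ca cb) cc) cd)).
Qed.

End Apply.

Ltac computable_by lem :=
  unshelve (refine lem);
  lazymatch goal with
  | |- rep _ => typeclasses eauto
  | |- computable1 _ => typeclasses eauto
  | |- computable2 _ => typeclasses eauto
  | |- computable3 _ => typeclasses eauto
  | |- computable4 _ => typeclasses eauto
  | |- _ => cbv beta
  end.

(* Hooks, redefined once the list operations are shown to be computable *)
Ltac computable_list_step := fail.
Ltac computable_mem_step := fail.

(** Terms free of the bound variable are settled as constants before anything is taken apart;
    functions registered as instances are tried last, by arity. *)
Ltac computable_step :=
  lazymatch goal with
  | |- computable (fun c => _) => idtac
  | |- computable ?f => change (computable (fun c => f c))
  end;
  first
  [ assumption
  | lazymatch goal with
    | |- computable (fun c => ?b) => exact (computable_const b) end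
  | lazymatch goal with
    | |- computable (fun c => c) => exact computable_id
    | |- computable (fun c => (_, _)) =>
        computable_by uconstr:(computable_pair _ _)
    | |- computable (fun c => fst _) => computable_by uconstr:(computable_fst _)
    | |- computable (fun c => snd _) => computable_by uconstr:(computable_snd _)
    | |- computable (fun c => _ :: _) =>
        computable_by uconstr:(computable_cons _ _)
    | |- computable (fun c => S _) => computable_by uconstr:(computable_succn _)
    | |- computable (fun c => iteri _ _ _) =>
        computable_by uconstr:(computable_iteri _ _ _)
    | |- computable (fun c => foldr _ _ _) =>
        computable_by uconstr:(computable_foldr _ _ _)
    | |- computable (fun c => if _ then _ else _) =>
        computable_by uconstr:(computable_if _ _ _)
    end
  | computable_list_step
  | computable_mem_step
  | lazymatch goal with |- computable (fun c => ?f (@?a c)) =>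
      computable_by uconstr:(computable_app1 (f := f) (a := a) _) end
  | lazymatch goal with |- computable (fun c => ?f (@?a c) (@?b c)) =>
      computable_by uconstr:(computable_app2 (f := f) (a := a) (b := b) _ _) end
  | lazymatch goal with |- computable (fun c => ?f (@?a c) (@?b c) (@?d c)) =>
      computable_by uconstr:(computable_app3 (f := f)
        (a := a) (b := b) (c := d) _ _ _) end
  | lazymatch goal with
      |- computable (fun c => ?f (@?a c) (@?b c) (@?d c) (@?e c)) =>
      computable_by uconstr:(computable_app4 (f := f)
        (a := a) (b := b) (c := d) (d := e) _ _ _ _) end ].

Ltac computability :=
  try unfold computable1; try unfold computable2; try unfold computable3;
  try unfold computable4; cbv beta; repeat computable_step.

#[local] Instance computable_negb : computable1 negb.
Proof.
by apply: (computable_ext (fun b : bool => if b then false else true));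
  [computability|case].
Qed.

#[local] Instance computable_andb : computable2 andb.
Proof.
by apply: (computable_ext (fun c : bool * bool => if c.1 then c.2 else false));
  [computability|].
Qed.

#[local] Instance computable_orb : computable2 orb.
Proof.
by apply: (computable_ext (fun c : bool * bool => if c.1 then true else c.2));
  [computability|].
Qed.

#[local] Instance computable_predn : computable1 predn.
Proof.
by apply: (computable_ext (fun n : nat => iteri n (fun i _ => i) 0));
  [computability|case].
Qed.

#[local] Instance computable_addn : computable2 addn.
Proof.
apply: (computable_ext (fun c : nat * nat => iteri c.1 (fun _ r => r.+1) c.2)).
  computability.
by case=> n k /=; elim: n => //= n ->.
Qed.

#[local] Instance computable_subn : computable2 subn.
Proof.
apply: (computable_ext (fun c : nat * nat => iteri c.2 (fun _ r => r.-1) c.1)).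
  computability.
by case=> n k /=; elim: k => [|k /= ->]; rewrite (subn0, subnS).
Qed.

#[local] Instance computable_muln : computable2 muln.
Proof.
apply: (computable_ext (fun c : nat * nat => iteri c.1 (fun _ r => c.2 + r) 0)).
  computability.
by case=> n k /=; elim: n => //= n ->; rewrite mulSn.
Qed.

#[local] Instance computable_leq : computable2 leq.
Proof.
apply: (computable_ext
  (fun c : nat * nat => iteri (c.1 - c.2) (fun _ _ => false) true)).
  computability.
by case=> n k /=; rewrite -subn_eq0; case: (n - k).
Qed.

#[local] Instance computable_eqn : computable2 (@eq_op nat).
Proof.
apply: (computable_ext (fun c : nat * nat => (c.1 <= c.2) && (c.2 <= c.1))).
  computability.
by move=> c; rewrite eqn_leq.
Qed.

#[local] Instance computable_eqb : computable2 (@eq_op bool).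
Proof.
by apply: (computable_ext (fun c : bool * bool => if c.1 then c.2 else ~~ c.2));
  [computability|case=> [[] []]].
Qed.

(** * Computability of list operations *)

Section Lists.
Context {A B X : Type} {rA : rep A} {rB : rep B} {rX : rep X}.

#[local] Instance computable_size : computable1 (@size A).
Proof.
apply: (computable_ext (fun s : seq A => foldr (fun _ n => n.+1) 0 s)).
  computability.
by elim=> //= a s ->.
Qed.

#[local] Instance computable_cat : computable2 (@cat A).
Proof.
apply: (computable_ext
  (fun c : seq A * seq A => foldr (fun a r => a :: r) c.2 c.1)).
  computability.
by case=> s t /=; elim: s => //= a s ->.
Qed.

#[local] Instance computable_rev : computable1 (@rev A).
Proof.
apply: (computable_ext
  (fun s : seq A => foldr (fun a t => t ++ [:: a]) [::] s)).
  computability.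
by elim=> //= a s ->; rewrite rev_cons cats1.
Qed.

#[local] Instance computable_head : computable2 (@head A).
Proof.
apply: (computable_ext (fun c : A * seq A => foldr (fun a _ => a) c.1 c.2)).
  computability.
by case=> x [].
Qed.

#[local] Instance computable_behead : computable1 (@behead A).
Proof.
(* The predecessor trick: the fold returns the tail paired with the whole list. *)
apply: (computable_ext (fun s : seq A =>
  (foldr (fun a r => (r.2, a :: r.2)) ([::], [::]) s).1)).
  computability.
case=> //= a s; elim: s => //= b s IHs.
by rewrite -[in RHS]IHs.
Qed.

#[local] Instance computable_drop : computable2 (@drop A).
Proof.
apply: (computable_ext
  (fun c : nat * seq A => iteri c.1 (fun _ t => behead t) c.2)).
  computability.
case=> n s /=; elim: n => [|n IHn] /=; first by rewrite drop0.
by rewrite IHn -drop1 drop_drop.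
Qed.

#[local] Instance computable_nth : computable3 (@nth A).
Proof.
apply: (computable_ext
  (fun c : A * seq A * nat => head c.1.1 (drop c.2 c.1.2))).
  computability.
by case=> [[x s] n] /=; rewrite -nth0 nth_drop addn0.
Qed.

#[local] Instance computable_flatten : computable1 (@flatten A).
Proof.
by apply: (computable_ext
  (fun ss : seq (seq A) => foldr (fun s r => s ++ r) [::] ss));
  [computability|].
Qed.

Lemma computable_map (f : X -> A -> B) (s : X -> seq A) :
  computable (fun c : X * A => f c.1 c.2) -> computable s ->
  computable (fun x => map (f x) (s x)).
Proof.
move=> f_comp s_comp; have f_inst : computable2 f := f_comp.
apply: (computable_ext
  (fun x => foldr (fun a r => f x a :: r) [::] (s x))); first computability.
by move=> x; elim: (s x) => //= a t ->.
Qed.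

Lemma computable_filter (p : X -> pred A) (s : X -> seq A) :
  computable (fun c : X * A => p c.1 c.2) -> computable s ->
  computable (fun x => filter (p x) (s x)).
Proof.
move=> p_comp s_comp; have p_inst : computable2 (p : X -> A -> bool) := p_comp.
apply: (computable_ext (fun x =>
  foldr (fun a r => if p x a then a :: r else r) [::] (s x))).
  computability.
by move=> x; elim: (s x) => //= a t ->.
Qed.

Lemma computable_has (p : X -> pred A) (s : X -> seq A) :
  computable (fun c : X * A => p c.1 c.2) -> computable s ->
  computable (fun x => has (p x) (s x)).
Proof.
move=> p_comp s_comp; have p_inst : computable2 (p : X -> A -> bool) := p_comp.
apply: (computable_ext
  (fun x => foldr (fun a r => p x a || r) false (s x))); first computability.
by move=> x; elim: (s x) => //= a t ->.
Qed.

Lemma computable_all (p : X -> pred A) (s : X -> seq A) :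
  computable (fun c : X * A => p c.1 c.2) -> computable s ->
  computable (fun x => all (p x) (s x)).
Proof.
move=> p_comp s_comp; have p_inst : computable2 (p : X -> A -> bool) := p_comp.
apply: (computable_ext
  (fun x => foldr (fun a r => p x a && r) true (s x))); first computability.
by move=> x; elim: (s x) => //= a t ->.
Qed.

Lemma computable_find (p : X -> pred A) (s : X -> seq A) :
  computable (fun c : X * A => p c.1 c.2) -> computable s ->
  computable (fun x => find (p x) (s x)).
Proof.
move=> p_comp s_comp; have p_inst : computable2 (p : X -> A -> bool) := p_comp.
apply: (computable_ext (fun x =>
  foldr (fun a r => if p x a then 0 else r.+1) 0 (s x))).
  computability.
by move=> x; elim: (s x) => //= a t ->.
Qed.

Lemma computable_foldl (F : X -> B -> A -> B) (b : X -> B) (s : X -> seq A) :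
  computable (fun c : X * B * A => F c.1.1 c.1.2 c.2) ->
  computable b -> computable s ->
  computable (fun x => foldl (F x) (b x) (s x)).
Proof.
move=> F_comp b_comp s_comp; have F_inst : computable3 F := F_comp.
apply: (computable_ext (fun x =>
  foldr (fun a r => F x r a) (b x) (rev (s x)))); first computability.
by move=> x; rewrite -foldl_rev revK.
Qed.

End Lists.

Lemma computable_iter (A B : Type) (rA : rep A) (rB : rep B) (n : A -> nat)
    (F : A -> B -> B) (x : A -> B) :
  computable n -> computable (fun c : A * B => F c.1 c.2) -> computable x ->
  computable (fun a => iter (n a) (F a) (x a)).
Proof.
move=> n_comp F_comp x_comp; have F_inst : computable2 F := F_comp.
by apply: (computable_ext (fun a => iteri (n a) (fun _ => F a) (x a)));
  [computability|].
Qed.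

#[local] Existing Instances computable_size computable_cat computable_rev
  computable_head computable_behead computable_drop computable_nth
  computable_flatten.

Ltac computable_list_step ::=
  lazymatch goal with
  | |- computable (fun c => map _ _) =>
      computable_by uconstr:(computable_map _ _)
  | |- computable (fun c => filter _ _) =>
      computable_by uconstr:(computable_filter _ _)
  | |- computable (fun c => has _ _) =>
      computable_by uconstr:(computable_has _ _)
  | |- computable (fun c => all _ _) =>
      computable_by uconstr:(computable_all _ _)
  | |- computable (fun c => find _ _) =>
      computable_by uconstr:(computable_find _ _)
  | |- computable (fun c => foldl _ _ _) =>
      computable_by uconstr:(computable_foldl _ _ _)
  | |- computable (fun c => iter _ _ _) =>
      computable_by uconstr:(computable_iter _ _ _)
  end.

#[local] Instance computable_iota : computable2 iota.
Proof.
apply: (computable_ext (fun c : nat * nat =>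
  map (fun i => c.1 + i) (iteri c.2 (fun i s => s ++ [:: i]) [::]))).
  computability.
case=> k n /=; suff -> : iteri n (fun i s => s ++ [:: i]) [::] = iota 0 n.
  by rewrite -iotaDl addn0.
by elim: n => [|n IHn] //; rewrite iteriS IHn -[in RHS]addn1 iotaD.
Qed.

Section Equality.
Context {A B : eqType} {rA : rep A} {rB : rep B}.
Context {eA : computable2 (@eq_op A)} {eB : computable2 (@eq_op B)}.

#[local] Instance computable_eq_prod : computable2 (@eq_op (A * B)%type).
Proof.
apply: (computable_ext (fun c : (A * B) * (A * B) =>
  (c.1.1 == c.2.1) && (c.1.2 == c.2.2))); first computability.
by case=> [[a b] [c d]].
Qed.

#[local] Instance computable_eq_seq : computable2 (@eq_op (seq A)).
Proof.
(* The fold pops [c.1] while it reads [c.2]. On an exhausted list [head a] returns [a] and the test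
   succeeds, so lengths are compared separately. *)
apply: (computable_ext (fun c : seq A * seq A => (size c.1 == size c.2) &&
  (foldl (fun r a => (behead r.1, r.2 && (head a r.1 == a)))
     (c.1, true) c.2).2)); first computability.
case=> s t /=; set F := foldl _.
have F_false s' t' : (F (s', false) t').2 = false by elim: t' s' => /=.
elim: t s => [|b t IHt] [|a s] //=.
rewrite eqSS eqseq_cons -IHt; case: (a == b); first by rewrite andTb.
by rewrite F_false andbF.
Qed.

#[local] Instance computable_index : computable2 (@index A).
Proof.
by apply: (computable_ext (fun c : A * seq A =>
  find (fun y => y == c.1) c.2)); [computability|].
Qed.

Lemma computable_mem (X : Type) (rX : rep X) (x : X -> A) (s : X -> seq A) :
  computable x -> computable s -> computable (fun b => x b \in s b).
Proof.
move=> x_comp s_comp; have x_inst : computable1 x := x_comp.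
apply: (computable_ext (fun b => has (fun y => y == x b) (s b))).
  computability.
by move=> b; rewrite -has_pred1.
Qed.

End Equality.

#[local] Existing Instances computable_eq_prod computable_eq_seq
  computable_index.

Ltac computable_mem_step ::=
  lazymatch goal with
  | |- computable (fun c => in_mem _ (mem _)) =>
      computable_by uconstr:(computable_mem _ _)
  end.

(** * Reduced words and normal forms *)

Local Open Scope group_scope.

Definition flip (u : nat * bool) : nat * bool := (u.1, ~~ u.2).

(* Reduced words are stored as stacks: the head is the last letter. *)
(* Since u <> flip u, the test fails on the empty stack. *)
Definition push (s : seq (nat * bool)) (u : nat * bool) : seq (nat * bool) :=
  if head u s == flip u then behead s else u :: s.

Definition reduced_stack (s : seq (nat * bool)) : bool :=
  sorted (fun u v => v != flip u) s.

Lemma head_push (s : seq (nat * bool)) u :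
  (head u s == flip u) = (if s is v :: _ then v == flip u else false).
Proof.
by case: s => //=; case: u => i [] //=; rewrite /flip xpair_eqE eqxx.
Qed.

Lemma push_reduced s u : reduced_stack s -> reduced_stack (push s u).
Proof.
rewrite /push head_push; case: s => [|v s] //= red_s.
case: ifP => [_|/negbT uv /=]; first exact: path_sorted red_s.
by rewrite uv.
Qed.

Section Stacks.
Variables (G : groupType) (b : nat -> G).

Definition lval (u : nat * bool) : G := sletter_val (b u.1, u.2).

Fixpoint fvals (s : seq (nat * bool)) : G :=
  if s is u :: s' then fvals s' * lval u else 1.

Lemma lval_flip u : lval (flip u) = (lval u)^-1.
Proof. by case: u => i []; rewrite /lval /sletter_val //= invgK. Qed.

Lemma fvals_push s u : fvals (push s u) = fvals s * lval u.
Proof.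
rewrite /push head_push; case: s => [|v s] //=.
by case: eqP => [->|] //=; rewrite lval_flip mulgVK.
Qed.

Lemma fvals_cat s s' : fvals (s ++ s') = fvals s' * fvals s.
Proof. by elim: s => [|u s IHs] /=; rewrite ?mulg1 // IHs mulgA. Qed.

Lemma fvals_pushes s w : fvals (foldl push s w) = fvals s * fvals (rev w).
Proof.
elim: w s => [|u w IHw] s /=; first by rewrite mulg1.
by rewrite IHw fvals_push rev_cons -cats1 fvals_cat /= mul1g mulgA.
Qed.

Lemma fvals_revE s : fvals (rev s) = \prod_(u <- s) lval u.
Proof.
elim: s => [|u s IHs]; first by rewrite big_nil.
by rewrite rev_cons -cats1 fvals_cat big_cons IHs /= mul1g.
Qed.

End Stacks.

(* The transition rule of Schreier rewriting: cos t * z = h * cos t', where the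
   pair (h, t') is looked up in a finite table; the default value is the right
   one for the codes of no letter, as these denote 1. *)
Definition table_entry (tbl : seq (seq (seq (nat * bool) * nat))) (t i : nat) :
    seq (nat * bool) * nat :=
  nth ([::], t) (nth [::] tbl t) i.

(** Only the basis letters that occur in the table are numbered, so the basis may be infinite.
    Several representatives may share a coset; [canonical] singles out one index for each, and
    normal forms are unique for these. *)
Record free_coset_data (G : groupType) (Z : seq G) := FreeCosetData {
  nlet : nat;
  ncos : nat;
  bas : nat -> G;
  cos : nat -> G;
  canonical : pred nat;
  table : seq (seq (seq (nat * bool) * nat));
  cos0 : cos 0 = 1;
  canonical0 : canonical 0;
  canonical_lt : forall t, canonical t -> t < ncos;
  entry_canonical : forall t i, canonical t ->
    canonical (table_entry table t i).2;
  entry_lt : forall t i, t < ncos -> (table_entry table t i).2 < ncos;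
  entry_letters : forall t i, t < ncos ->
    all (fun u => u.1 < nlet) (table_entry table t i).1;
  entry_val : forall t i, t < ncos ->
    fvals bas (rev (table_entry table t i).1) * cos (table_entry table t i).2
    = cos t * letter Z i;
  normal_form_uniq : forall s s' t t',
    reduced_stack s -> reduced_stack s' ->
    all (fun u => u.1 < nlet) s -> all (fun u => u.1 < nlet) s' ->
    canonical t -> canonical t' ->
    fvals bas s * cos t = fvals bas s' * cos t' -> s = s' /\ t = t'
}.

(** Membership in [H] and words for its elements are obtained classically; this does not affect
    effectiveness, as the algorithm sees only the resulting finite table. *)
Lemma free_coset_data_exists (G : groupType) (Z : seq G) :
  virtually_free G -> inhabited (free_coset_data Z).
Proof.
case=> H [[[H1 Hdiv] [B [BH Hbasis]]] [T0 HT0]].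
have HV x : H x -> H x^-1 by rewrite -div1g; exact: Hdiv.
have HM x y : H x -> H y -> H (x * y).
  by move=> Hx Hy; rewrite -[y]invgK; apply: Hdiv => //; exact: HV.
(* With 1 in front, the coset [H] itself gets index 0 and representative 1. *)
pose T := 1 :: T0.
pose idx g := find (fun t => boolp.asbool (H (g / t))) T.
have idx_has g : has (fun t => boolp.asbool (H (g / t))) T.
  have [t tT Ht] := HT0 g; apply/hasP; exists t; first by rewrite inE tT orbT.
  by apply/boolp.asboolP.
have idx_lt g : idx g < size T by rewrite -has_find.
have idxP g : H (g / nth 1 T (idx g)).
  by apply/boolp.asboolP; exact: (nth_find 1 (idx_has g)).
have idxM h g : H h -> idx (h * g) = idx g.
  move=> Hh; apply: eq_find => t; apply/boolp.asbool_equiv_eq; rewrite -mulgA.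
  by split=> Hg; [rewrite -[g / t](mulKg h)|]; apply: HM => //; exact: HV.
have idxK g : idx (nth 1 T (idx g)) = idx g.
  have -> : nth 1 T (idx g) = (g / nth 1 T (idx g))^-1 * g.
    by rewrite invgF mulgVK.
  by apply/idxM/HV.
have /boolp.choice [W WP] : forall h, exists w, H h ->
    [/\ forall u, u \in w -> B u.1, reduced w
      & \prod_(u <- w) sletter_val u = h].
  move=> h.
  have [Hh|nHh] := boolp.pselect (H h); last by exists [::].
  by have [w [wP _]] := Hbasis h Hh; exists w.
pose gz t i := nth 1 T t * letter Z i.
pose wd t i := W (gz t i / nth 1 T (idx (gz t i))).
have wdP t i := WP _ (idxP (gz t i)).
(* The letters of the finitely many words in the table; a letter is coded by its position here. *)
pose Bs := undup [seq u.1 | u <- flatten [seq wd t i |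
  t <- iota 0 (size T), i <- iota 0 (size (symm Z))]].
have wdBs t i u : t < size T -> i < size (symm Z) -> u \in wd t i -> u.1 \in Bs.
  move=> lt_t lt_i uw; rewrite mem_undup; apply: map_f; apply/flattenP.
  by exists (wd t i) => //; apply: allpairs_f; rewrite mem_iota.
have BsB x : x \in Bs -> B x.
  rewrite mem_undup => /mapP [u /flattenP [w /allpairsP [[t i] [_ _ ->]]]].
  by move=> uw ->; have [+ _ _] := wdP t i; apply.
pose code (u : G * bool) := (index u.1 Bs, u.2).
pose tbl := [seq [seq ([seq code u | u <- wd t i], idx (gz t i)) |
  i <- iota 0 (size (symm Z))] | t <- iota 0 (size T)].
pose ent := table_entry tbl.
have entE t i : t < size T -> ent t i =
    if i < size (symm Z) then ([seq code u | u <- wd t i], idx (gz t i))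
    else ([::], t).
  move=> lt_t; rewrite /ent /table_entry (nth_map 0) ?size_iota // nth_iota //.
  case: ltnP => lt_i; last by rewrite nth_default ?size_map ?size_iota.
  by rewrite (nth_map 0) ?size_iota // nth_iota.
pose canon t := boolp.asbool (exists g, idx g = t).
have canonP t : reflect (exists g, idx g = t) (canon t) by exact: boolp.asboolP.
have canon_lt t : canon t -> t < size T by case/canonP=> g <-.
have canon_idx g : canon (idx g) by apply/canonP; exists g.
pose dec (u : nat * bool) := (nth 1 Bs u.1, u.2).
have dec_inj : {in [pred u : nat * bool | u.1 < size Bs] &, injective dec}.
  move=> [i e] [j f] /= lt_i lt_j [/eqP + ->].
  by rewrite nth_uniq ?undup_uniq // => /eqP ->.
have decP s : reduced_stack s -> all (fun u => u.1 < size Bs) s ->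
    [/\ forall u, u \in map dec (rev s) -> B u.1, reduced (map dec (rev s))
      & \prod_(u <- map dec (rev s)) sletter_val u = fvals (nth 1 Bs) s].
  move=> red_s lt_s; split.
  - move=> u /mapP [v]; rewrite mem_rev => /(allP lt_s) lt_v ->.
    by apply/BsB/mem_nth.
  - rewrite /reduced map_rev rev_sorted sorted_map.
    apply: sub_in_sorted lt_s red_s => [[i e] [j f]] /= lt_i lt_j.
    apply: contra => /andP [ij ef]; rewrite /flip xpair_eqE /=.
    move: ij ef; rewrite nth_uniq ?undup_uniq // => ->.
    by case: (e) (f) => [] [].
  by rewrite big_map -fvals_revE revK.
have fvalsH s : reduced_stack s -> all (fun u => u.1 < size Bs) s ->
    H (fvals (nth 1 Bs) s).
  move=> _; elim: s => //= u s IHs /andP [lt_u /IHs Hs]; apply: HM => //.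
  have Hu : H (nth 1 Bs u.1) by apply/BH/BsB/mem_nth.
  by rewrite /lval /sletter_val /=; case: u.2 => //; exact: HV.
split.
apply: (@FreeCosetData G Z (size Bs) (size T) (nth 1 Bs) (nth 1 T) canon tbl).
- by [].
- by apply/canonP; exists 1; rewrite /idx /= divg1 ifT //; apply/boolp.asboolP.
- exact: canon_lt.
- move=> t i ct; change (canon (ent t i).2).
  by rewrite entE ?canon_lt //; case: ifP => _ //=; exact: canon_idx.
- move=> t i lt_t; change ((ent t i).2 < size T).
  by rewrite entE //; case: ifP => // _; exact: idx_lt.
- move=> t i lt_t; change (all (fun u => u.1 < size Bs) (ent t i).1).
  rewrite entE //; case: ifP => // lt_i; apply/allP=> u /mapP [v vw ->] /=.
  by rewrite index_mem; exact: wdBs vw.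
- move=> t i lt_t.
  change (fvals (nth 1 Bs) (rev (ent t i).1) * nth 1 T (ent t i).2 = gz t i).
  rewrite entE //; case: ltnP => lt_i /=; last first.
    by rewrite mul1g /gz /letter (nth_default _ lt_i) mulg1.
  have [_ _ wv] := wdP t i; rewrite fvals_revE big_map.
  rewrite -[RHS](mulgVK (nth 1 T (idx (gz t i)))) -wv; congr (_ * _).
  apply: eq_big_seq => u /(wdBs _ _ _ lt_t lt_i) uB.
  by rewrite /lval /= nth_index //; case: u {uB}.
move=> s s' t t' red_s red_s' lt_s lt_s' /canonP [g <-] /canonP [g' <-] E.
have Et : idx g = idx g'.
  have Hs := fvalsH s red_s lt_s; have Hs' := fvalsH s' red_s' lt_s'.
  by rewrite -[LHS]idxK -(idxM _ _ Hs) E (idxM _ _ Hs') idxK.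
split=> //; move: E; rewrite Et => /mulIg E.
have [w [_ uniq_w]] := Hbasis _ (fvalsH s red_s lt_s).
have eq_w : map dec (rev s) = map dec (rev s').
  transitivity w; first by apply/esym/uniq_w/decP.
  by apply: uniq_w; rewrite E; exact: decP.
apply: (can_inj revK); apply: (inj_in_map dec_inj) eq_w;
  by rewrite inE all_rev.
Qed.

(** * The algorithm *)

Local Open Scope nat_scope.

Notation stack := (seq (nat * bool)).
(* (r, p, t): the word r remains to be read before the given automaton is in
   state p and the coset is t. *)
Notation astate := (stack * nat * nat)%type.
(* (q, l, q'): one can go from q to q' by reading a word equal to l in the free
   group; l has at most one letter. *)
Notation triple := (astate * stack * astate)%type.
(* Relative to a word v, a marked word (u, b) stands for a competitor w with
   value v u and at most as many letters as v, fewer if b holds. *)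
Notation marked := (seq nat * bool)%type.
(* (q, u, S): the normal form read up to q, times the value of u, is the value
   of the input, and S holds the competitors near the input. *)
Notation gstate := (astate * seq nat * seq marked)%type.

Definition words (n k : nat) : seq (seq nat) :=
  iter k (fun S => [::] :: [seq j :: v | j <- iota 0 n, v <- S]) [:: [::]].

Definition subseqs (A : Type) (s : seq A) : seq (seq A) :=
  foldr (fun a r => r ++ map (cons a) r) [:: [::]] s.

Definition saturate (A : eqType) (rule : seq A -> A -> bool) (U : seq A) :=
  iter (size U) (fun S => [seq a <- U | rule S a]) [::].

Section Algorithm.
(* In the application, m is the size of Z, and nc, nl and tbl are the fields
   ncos, nlet and table of free_coset_data. *)
Variables (m nc nl : nat) (tbl : seq (seq (stack * nat))).
Variable consts : seq (seq nat).

(** In [symm Z] a letter and its inverse stand [m] places apart; positions past the end denote 1 and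
    are left alone. *)
Definition zinv (i : nat) : nat :=
  if i < m then m + i else if i < m + m then i - m else i.

Definition winv (w : seq nat) : seq nat := rev [seq zinv i | i <- w].

Definition act1 (st : stack * nat) (i : nat) : stack * nat :=
  (foldl push st.1 (table_entry tbl st.2 i).1, (table_entry tbl st.2 i).2).

Definition act (st : stack * nat) (w : seq nat) : stack * nat :=
  foldl act1 st w.

Definition nform (w : seq nat) : stack * nat := act ([::], 0) w.

Definition spell (y : seq (seq nat)) (i : nat) : seq nat :=
  nth [::] (y ++ [seq winv w | w <- y]) i.

Definition spellw (y : seq (seq nat)) (v : seq nat) : seq nat :=
  flatten [seq spell y i | i <- v].

Definition nsymm (y : seq (seq nat)) : nat := size y + size y.

Definition within (y : seq (seq nat)) (k : nat) (w : seq nat) : bool :=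
  has (fun v => nform (spellw y v) == nform w) (words (nsymm y) k).

(** The test of the unbounded search: [lam] will be the least [k] that bounds the length over Y of
    all constants. Equality in the group is decided by normal forms. *)
Definition covers (y : seq (seq nat)) (k : nat) : bool :=
  all (fun w => within y k w) consts.

(* The factor 10 comes from [fellow_travel]. *)
Definition radius (y : seq (seq nat)) (lam : nat) : nat :=
  10 * (lam * (size (flatten y)).+1).

(* The competitor either reads a letter as well or stays where it is, in which
   case it becomes strictly shorter than the input. *)
Definition mark_step (y : seq (seq nat)) (j : nat) (c d : marked) : bool :=
  (has (fun i => nform (winv (spell y j) ++ (spellw y c.1 ++ spell y i)) ==
                 nform (spellw y d.1)) (iota 0 (nsymm y)) && (c.2 == d.2))
  || ((nform (winv (spell y j) ++ spellw y c.1) == nform (spellw y d.1))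
      && d.2).

Definition marks_step (y : seq (seq nat)) (U : seq marked) (S : seq marked)
    (j : nat) : seq marked :=
  [seq d <- U | has (fun c => mark_step y j c d) S].

(** Such a marked word comes from a strictly shorter word with the same value as the input. *)
Definition overtaken (y : seq (seq nat)) (S : seq marked) : bool :=
  has (fun c => c.2 && (nform (spellw y c.1) == ([::], 0))) S.

Definition run_edge (x : seq (seq nat)) (t : nat) (e : nat * nat * nat) :=
  act ([::], t) (spell x e.1.2).

(** The product of [M] with the cosets, where each edge is subdivided so as to read one free letter
    at a time; the words [drop k] are what is left at its intermediate points. *)
Definition astates (x : seq (seq nat)) (M : den nfaT) : seq astate :=
  [seq ([::], p, t) | p <- M.1.1, t <- iota 0 nc] ++
  flatten [seq [seq (drop k (rev (run_edge x et.2 et.1).1), et.1.2,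
                     (run_edge x et.2 et.1).2)
               | k <- iota 0 (size (run_edge x et.2 et.1).1 + 1)]
          | et <- [seq (e, t) | e <- M.2, t <- iota 0 nc]].

Definition labels : seq stack :=
  [seq [:: (i, b)] | i <- iota 0 nl, b <- [:: true; false]] ++ [:: [::]].

Definition triples (Q : seq astate) : seq triple :=
  [seq (ql, q') | ql <- [seq (q, l) | q <- Q, l <- labels], q' <- Q].

(** Either the next letter of the remainder is read, or nothing at all; or an edge of [M] is entered
    silently, which leaves a word to be read and a new coset. *)
Definition base_triple (x : seq (seq nat)) (M : den nfaT) (c : triple) : bool :=
  [&& c.1.1.1.1 == c.1.2 ++ c.2.1.1, c.1.1.1.2 == c.2.1.2
    & c.1.1.2 == c.2.2]
  || [&& c.1.1.1.1 == [::], c.1.2 == [::]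
    & has (fun e => [&& e.1.1 == c.1.1.1.2, e.2 == c.2.1.2
        & run_edge x c.1.1.2 e == (rev c.2.1.1, c.2.2)]) M.2].

(** The rule of Benois: two steps compose, with free cancellation. Since [triples] holds only labels
    of at most one letter, the set of steps stays finite. *)
Definition join_triple (T : seq triple) (c : triple) : bool :=
  has (fun c1 => has (fun c2 => [&& c1.1.1 == c.1.1, c1.2 == c2.1.1,
    c2.2 == c.2 & foldl push c1.1.2 c2.1.2 == c.1.2]) T) T.

Definition benois (x : seq (seq nat)) (M : den nfaT) : seq triple :=
  saturate (fun T c => base_triple x M c || join_triple T c)
    (triples (astates x M)).

(** The fold starts at the bottom of the stack, which is the first letter. Silent steps between
    letters are already absorbed by saturation. *)
Definition reads (T : seq triple) (Q : seq astate) (q : astate) (s : stack) :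
    seq astate :=
  foldr (fun u S => [seq q' <- Q | has (fun q1 => (q1, [:: u], q') \in T) S])
    [seq q' <- Q | (q, [::], q') \in T] s.

(** Coset 0 has representative 1, so [st.2 == 0] says that the element is a word in the free letters
    alone. *)
Definition readable (TQ : seq triple * seq astate) (q : astate)
    (st : stack * nat) (q' : astate) : bool :=
  (st.2 == 0) && (q' \in reads TQ.1 TQ.2 q st.1).

(** If u and u' stand for a(i)^-1 v(i) and a(i+1)^-1 v(i+1), then a(i)^-1 a(i+1) equals u j u'^-1;
    its normal form is read in the saturated automaton while the letter j is consumed. *)
Definition geo_edge (y : seq (seq nat)) (U : seq marked)
    (TQ : seq triple * seq astate) (c : gstate * nat * gstate) : bool :=
  [&& readable TQ c.1.1.1.1
        (nform (spellw y c.1.1.1.2 ++ (spell y c.1.2 ++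
                winv (spellw y c.2.1.2)))) c.2.1.1,
      c.2.2 == marks_step y U c.1.1.2 c.1.2 & ~~ overtaken y c.2.2].

Definition geo_final (y : seq (seq nat)) (F : seq nat)
    (TQ : seq triple * seq astate) (c : gstate) : bool :=
  has (fun p => ([::], p, (nform (spellw y c.1.2)).2) \in
    reads TQ.1 TQ.2 c.1.1 (nform (spellw y c.1.2)).1) F.

Definition marks (W : seq (seq nat)) : seq marked :=
  [seq (v, b) | v <- W, b <- [:: false; true]].

Definition gstates (Q : seq astate) (W : seq (seq nat)) : seq gstate :=
  [seq (qv, ms) | qv <- [seq (q, v) | q <- Q, v <- W],
                 ms <- subseqs (marks W)].

Definition assemble (sts : seq gstate) (init : seq nat) (fin : seq gstate)
    (edges : seq (gstate * nat * gstate)) : den nfaT :=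
  (([seq index ([::], p, 0, [::], [:: ([::], false)]) sts | p <- init],
    [seq index c sts | c <- fin]),
   [seq (index c.1.1 sts, c.1.2, index c.2 sts) | c <- edges]).

Definition geo_nfa_aux (yW : seq (seq nat) * seq (seq nat)) (M : den nfaT)
    (TQ : seq triple * seq astate) (sts : seq gstate) : den nfaT :=
  assemble sts M.1.1 [seq c <- sts | geo_final yW.1 M.1.2 TQ c]
    [seq c <- [seq (cj, c') |
        cj <- [seq (c, j) | c <- sts, j <- iota 0 (nsymm yW.1)], c' <- sts]
     | geo_edge yW.1 (marks yW.2) TQ c].

Definition geo_nfa (c : seq (seq nat) * (seq (seq nat) * den nfaT) * nat) :
    den nfaT :=
  geo_nfa_aux (c.1.2.1, words (nsymm c.1.2.1) (radius c.1.2.1 c.2)) c.1.2.2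
    (benois c.1.1 c.1.2.2, astates c.1.1 c.1.2.2)
    (gstates (astates c.1.1 c.1.2.2)
      (words (nsymm c.1.2.1) (radius c.1.2.1 c.2))).

(* Instances of [rep] are found by the shape of the type, so [den nfaT] has to
   be unfolded. *)
Local Notation nfa_code := (seq nat * seq nat * seq (nat * nat * nat))%type.

#[local] Instance computable_push : computable2 push.
Proof. unfold push, flip. computability. Qed.

#[local] Instance computable_words : computable2 words.
Proof. unfold words; computability. Qed.

#[local] Instance computable_zinv : computable1 zinv.
Proof. unfold zinv. computability. Qed.

#[local] Instance computable_winv : computable1 winv.
Proof. unfold winv; computability. Qed.

#[local] Instance computable_table_entry : computable2 (table_entry tbl).
Proof. unfold table_entry; computability. Qed.

#[local] Instance computable_act1 : computable2 act1.
Proof. unfold act1; computability. Qed.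

#[local] Instance computable_act : computable2 act.
Proof. unfold act; computability. Qed.

#[local] Instance computable_nform : computable1 nform.
Proof. unfold nform; computability. Qed.

#[local] Instance computable_spell : computable2 spell.
Proof. unfold spell; computability. Qed.

#[local] Instance computable_spellw : computable2 spellw.
Proof. unfold spellw; computability. Qed.

#[local] Instance computable_nsymm : computable1 nsymm.
Proof. unfold nsymm; computability. Qed.

#[local] Instance computable_within : computable3 within.
Proof. unfold within; computability. Qed.

#[local] Instance computable_covers : computable2 covers.
Proof. unfold covers; computability. Qed.

#[local] Instance computable_radius : computable2 radius.
Proof. unfold radius; computability. Qed.

#[local] Instance computable_mark_step : computable4 mark_step.
Proof. unfold mark_step; computability. Qed.

#[local] Instance computable_marks_step : computable4 marks_step.
Proof. unfold marks_step; computability. Qed.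

#[local] Instance computable_overtaken : computable2 overtaken.
Proof. unfold overtaken; computability. Qed.

#[local] Instance computable_run_edge : computable3 run_edge.
Proof. unfold run_edge; computability. Qed.

#[local] Instance computable_astates :
  computable2 (astates : _ -> nfa_code -> _).
Proof. unfold astates; computability. Qed.

#[local] Instance computable_triples : computable1 triples.
Proof. unfold triples; computability. Qed.

#[local] Instance computable_base_triple :
  computable3 (base_triple : _ -> nfa_code -> _ -> _).
Proof. unfold base_triple; computability. Qed.

#[local] Instance computable_join_triple : computable2 join_triple.
Proof. unfold join_triple; computability. Qed.

#[local] Instance computable_benois : computable2 (benois : _ -> nfa_code -> _).
Proof. unfold benois, saturate; computability. Qed.

#[local] Instance computable_reads : computable4 reads.
Proof. unfold reads; computability. Qed.

#[local] Instance computable_readable : computable4 readable.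
Proof. unfold readable; computability. Qed.

#[local] Instance computable_geo_edge : computable4 geo_edge.
Proof. unfold geo_edge; computability. Qed.

#[local] Instance computable_geo_final : computable4 geo_final.
Proof. unfold geo_final; computability. Qed.

#[local] Instance computable_marks : computable1 marks.
Proof. unfold marks; computability. Qed.

#[local] Instance computable_gstates : computable2 gstates.
Proof. unfold gstates, subseqs; computability. Qed.

#[local] Instance computable_assemble :
  computable4 (assemble : _ -> _ -> _ -> _ -> nfa_code).
Proof. unfold assemble; computability. Qed.

#[local] Instance computable_geo_nfa_aux :
  computable4 (geo_nfa_aux : _ -> nfa_code -> _ -> _ -> nfa_code).
Proof. unfold geo_nfa_aux; computability. Qed.

#[local] Instance computable_geo_nfa :
  computable1 (geo_nfa : _ * (_ * nfa_code) * _ -> nfa_code).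
Proof. unfold geo_nfa; computability. Qed.

End Algorithm.

(** * Enumerations and suffixes of lists *)

Lemma mem_words n k (v : seq nat) :
  (v \in words n k) = all (fun j => j < n) v && (size v <= k).
Proof.
elim: k v => [|k IHk] [|j v]; rewrite ?inE //=.
  by rewrite andbF.
apply/allpairsP/idP => [[[i u]] /= [] | /andP [/andP [lt_j lt_v] le_v]].
  rewrite mem_iota -/(words n k) IHk => /= lt_i /andP [lt_u le_u] [-> ->].
  by rewrite lt_i lt_u ltnS.
by exists (j, v); rewrite mem_iota -/(words n k) IHk /= lt_j lt_v.
Qed.

(** A set of marked words is stored as a filtered copy of one fixed list, hence as a subsequence of
    it; this makes the state space finite. *)
Lemma mem_subseqs (A : eqType) (s t : seq A) : subseq s t -> s \in subseqs t.
Proof.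
elim: t s => [|a t IHt] s /=; first by rewrite inE.
rewrite mem_cat; case: s => [|b s] /=.
  by move=> _; rewrite IHt // sub0seq.
case: eqP => [-> /IHt st|_ /IHt -> //].
by apply/orP; right; apply: map_f.
Qed.

Lemma suffix_consE (T : eqType) (a : seq T) v t :
  suffix a (v :: t) = (a == v :: t) || suffix a t.
Proof.
apply/suffixP/orP => [[[|x r] /= E]|[/eqP ->|/suffixP [r ->]]].
- by left; rewrite E.
- by right; apply/suffixP; exists r; case: E.
- by exists [::].
by exists (v :: r).
Qed.

Lemma cat_injr (A : eqType) (s s' t : seq A) : s ++ t = s' ++ t -> s = s'.
Proof.
move=> E; have ss : size s = size s'.
  by have := congr1 size E; rewrite !size_cat => /addIn.
by move/eqP: E; rewrite eqseq_cat // => /andP [/eqP].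
Qed.

(** * Fixpoints in a finite universe *)

Section Saturation.
Variables (A : eqType) (rule : seq A -> A -> bool) (U : seq A).
Hypothesis rule_mono : forall S T a, {subset S <= T} -> rule S a -> rule T a.

Let stage n := iter n (fun S => [seq a <- U | rule S a]) [::].

Lemma saturate_ind (P : A -> Prop) :
  (forall S a, {in S, forall b, P b} -> a \in U -> rule S a -> P a) ->
  {in saturate rule U, forall a, P a}.
Proof.
move=> PS; rewrite /saturate; elim: (size U) => [|n IHn] a //=.
by rewrite mem_filter => /andP [ra aU]; exact: PS IHn aU ra.
Qed.

Let stageS n : {subset stage n <= stage n.+1}.
Proof.
elim: n => [|n IHn] a //=; rewrite !mem_filter => /andP [ra ->].
by rewrite andbT; apply: rule_mono ra.
Qed.

(** Every stage that is not closed gains an element of [U], so the increasing stages become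
    stationary within [size U] steps. *)
Lemma saturate_closed a :
  a \in U -> rule (saturate rule U) a -> a \in saturate rule U.
Proof.
suff [n len st] : exists2 n, n <= size U & {subset stage n.+1 <= stage n}.
  have stk k : {subset stage (n + k) <= stage n}.
    elim: k => [|k IHk]; first by rewrite addn0.
    move=> b; rewrite addnS [stage _.+1]/= => b_in; apply: st.
    move: b_in; rewrite [stage n.+1]/= !mem_filter => /andP [rb ->].
    by rewrite andbT; apply: rule_mono rb.
  have nst k : {subset stage n <= stage (n + k)}.
    elim: k => [|k IHk] b; first by rewrite addn0.
    by move=> /IHk bk; rewrite addnS; apply: stageS.
  move=> aU ra; rewrite /saturate -(subnKC len); apply/nst/st.
  rewrite [stage _.+1]/= mem_filter aU andbT; apply: rule_mono ra => b.
  by rewrite /saturate -(subnKC len) => /stk.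
have stageE n : stage n.+1 = [seq a <- U | a \in stage n.+1].
  by rewrite /=; apply: eq_in_filter => b bU; rewrite mem_filter bU andbT.
pose c n := count [in stage n] U.
have [/existsP [i /allP ci]|nofix] :=
    boolP [exists i : 'I_(size U).+1, all [in stage i] (stage i.+1)].
  by exists i => //; rewrite -ltnS.
suff : size U < c (size U).+1 by rewrite ltnNge count_size.
have: forall n, n <= (size U).+1 -> n <= c n; last exact.
elim=> // n IHn lt_n; apply: (leq_ltn_trans (IHn (ltnW lt_n))).
move: nofix; rewrite negb_exists => /forallP /(_ (Ordinal lt_n)) /=.
rewrite -has_predC => /hasP [b bn' /= bn].
have bU : b \in U by move: bn'; rewrite mem_filter => /andP [].
pose d := [predD [in stage n.+1] & [in stage n]].
have -> : c n.+1 = count (predU [in stage n] d) U.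
  apply: eq_count => e; rewrite !inE; case: (boolP (e \in stage n)) => //=.
  exact: stageS.
have := count_predUI [in stage n] d U.
have -> : count (predI [in stage n] d) U = 0.
  rewrite (eq_count (a2 := pred0)) ?count_pred0 // => e.
  by rewrite !inE andbA andbN.
rewrite addn0 => ->; rewrite -addn1 leq_add2l -has_count.
by apply/hasP; exists b => //; apply/andP.
Qed.
End Saturation.

Local Open Scope group_scope.

(** * Cuts in the Cayley graph *)

Lemma word_val_cat (G : groupType) (u v : seq G) :
  word_val (u ++ v) = word_val u * word_val v.
Proof. by rewrite /word_val big_cat. Qed.

Lemma size_symm (G : groupType) (X : seq G) :
  size (symm X) = (size X + size X)%N.
Proof. by rewrite size_cat size_map. Qed.

Lemma letter_zinv (G : groupType) (Z : seq G) i :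
  letter Z (zinv (size Z) i) = (letter Z i)^-1.
Proof.
rewrite /letter /symm /zinv; case: ltnP => [lt_i|le_i].
  rewrite !nth_cat lt_i ltnNge leq_addr /= addKn.
  by rewrite (nth_map 1).
case: ltnP => lt_i.
  have lt_im : i - size Z < size Z by rewrite ltn_subLR.
  by rewrite !nth_cat lt_im ltnNge le_i /= (nth_map 1) ?invgK.
by rewrite nth_default ?invg1 // size_symm.
Qed.

Section CosetData.
Variables (G : groupType) (Z : seq G) (D : free_coset_data Z).

Local Notation m := (size Z).
Local Notation tbl := (table D).
Local Notation letters_ok s := (all (fun u : nat * bool => u.1 < nlet D) s).

Definition zval (w : seq nat) : G := word_val [seq letter Z i | i <- w].

Lemma zval_cat u v : zval (u ++ v) = zval u * zval v.
Proof. by rewrite /zval map_cat word_val_cat. Qed.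

Lemma zval_cons i w : zval (i :: w) = letter Z i * zval w.
Proof. by rewrite /zval /word_val big_cons. Qed.

Lemma zval_nil : zval [::] = 1.
Proof. by rewrite /zval /word_val big_nil. Qed.

Lemma zval_winv w : zval (winv m w) = (zval w)^-1.
Proof.
elim: w => [|i w IHw]; first by rewrite zval_nil invg1.
rewrite /winv map_cons rev_cons -cats1 zval_cat IHw !zval_cons zval_nil.
by rewrite mulg1 letter_zinv invgM.
Qed.

Definition sval (st : stack * nat) : G := fvals (bas D) st.1 * cos D st.2.

Definition good (st : stack * nat) : bool :=
  [&& reduced_stack st.1, letters_ok st.1 & canonical D st.2].

Lemma good_inj st st' : good st -> good st' -> sval st = sval st' -> st = st'.
Proof.
case: st st' => [s t] [s' t'] /and3P [/= r l c] /and3P [/= r' l' c'].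
by move=> E; have [-> ->] := normal_form_uniq r r' l l' c c' E.
Qed.

Lemma push_letters s u :
  u.1 < nlet D -> letters_ok s -> letters_ok (push s u).
Proof.
rewrite /push => lt_u ls; case: ifP => _ /=; last by rewrite lt_u.
by case: s ls => //= v s /andP [].
Qed.

Lemma pushes_letters s w :
  letters_ok w -> letters_ok s -> letters_ok (foldl push s w).
Proof.
elim: w s => //= u w IHw s /andP [lt_u lw] ls.
by apply: IHw => //; exact: push_letters.
Qed.

Lemma pushes_reduced s w : reduced_stack s -> reduced_stack (foldl push s w).
Proof. by elim: w s => //= u w IHw s rs; apply: IHw; exact: push_reduced. Qed.

Lemma act_cat st u v : act tbl st (u ++ v) = act tbl (act tbl st u) v.
Proof. by rewrite /act foldl_cat. Qed.

Lemma act_lt st w : st.2 < ncos D -> (act tbl st w).2 < ncos D.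
Proof. by elim: w st => //= i w IHw st lt_t; apply: IHw; exact: entry_lt. Qed.

(** Stated for all coset indices in range, because the states of the automaton range over all of
    them, canonical or not. *)
Lemma act_val st w : st.2 < ncos D -> sval (act tbl st w) = sval st * zval w.
Proof.
elim: w st => [|i w IHw] st lt_t; first by rewrite zval_nil mulg1.
rewrite [act _ _ _]/= IHw; last exact: entry_lt.
rewrite zval_cons mulgA; congr (_ * _); rewrite /sval fvals_pushes -!mulgA.
by rewrite entry_val.
Qed.

Lemma act_letters st w :
  st.2 < ncos D -> letters_ok st.1 -> letters_ok (act tbl st w).1.
Proof.
elim: w st => //= i w IHw st lt_t ls; apply: IHw; first exact: entry_lt.
by apply: pushes_letters => //; exact: entry_letters.
Qed.

Lemma good_act st w : good st -> good (act tbl st w).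
Proof.
elim: w st => //= i w IHw st /and3P [rs ls ct]; apply: IHw; apply/and3P; split.
- exact: pushes_reduced.
- by apply: pushes_letters => //; apply/entry_letters/canonical_lt.
- exact: entry_canonical.
Qed.

Lemma good0 : good ([::], 0).
Proof. exact: canonical0. Qed.

Lemma good_nform w : good (nform tbl w).
Proof. exact/good_act/good0. Qed.

Lemma good_lt st : good st -> st.2 < ncos D.
Proof. by case/and3P=> _ _ /canonical_lt. Qed.

Lemma sval0 : sval ([::], 0) = 1.
Proof. by rewrite /sval /= cos0 mulg1. Qed.

Lemma nform_val w : sval (nform tbl w) = zval w.
Proof. by rewrite act_val ?sval0 ?mul1g //; exact: (good_lt good0). Qed.

Lemma nform_sval st w : good st -> sval st = zval w -> nform tbl w = st.
Proof.
by move=> gst E; apply: good_inj => //; [exact: good_nform|rewrite nform_val].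
Qed.

Lemma nform_eqP u v : reflect (zval u = zval v) (nform tbl u == nform tbl v).
Proof.
apply: (iffP eqP) => [E|E]; first by rewrite -!nform_val E.
by apply: nform_sval; rewrite ?nform_val //; exact: good_nform.
Qed.

(* In the tree of reduced words, removing the vertex [a] separates the words
   with prefix [a] from the others, so a path from one part to the other passes
   through [a]. *)
Lemma pushes_cut a s w : suffix a (foldl push s w) != suffix a s ->
  exists k, a = foldl push s (take k w).
Proof.
elim: w s => [|u w IHw] s /=; first by rewrite eqxx.
case: (altP (suffix a (push s u) =P suffix a s)) => [<- /IHw [k ->]|+ _].
  by exists k.+1.
have cut v t : suffix a (v :: t) != suffix a t -> a = v :: t.
  rewrite suffix_consE; case: (a =P v :: t) => [->|_] //=.
  by rewrite eqxx.
have [E|ne] := boolP (head u s == flip u); last first.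
  rewrite {1}/push (negbTE ne) => /cut ->; exists 1%N.
  by rewrite /= take0 /= /push (negbTE ne).
rewrite /push E; case: s E => [|v s] _ /=; first by rewrite eqxx.
by rewrite eq_sym => /cut ->; exists 0; rewrite take0.
Qed.

(** The vertex [a] is met while some table entry is being pushed, so it differs from the value of a
    prefix of [w] by one of finitely many elements that depend only on [D]. *)
Lemma act_cut a st w : st.2 < ncos D ->
  suffix a (act tbl st w).1 != suffix a st.1 ->
  exists n t i k, [/\ t < ncos D & fvals (bas D) a = sval st * zval (take n w) *
    ((cos D t)^-1 * fvals (bas D) (rev (take k (table_entry tbl t i).1)))].
Proof.
elim: w st => [|i w IHw] st lt_t; first by rewrite eqxx.
rewrite [act _ _ _]/=.
case: (altP (suffix a (act1 tbl st i).1 =P suffix a st.1)).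
  move=> <- /IHw [|n [t [j [k [lt_t' E]]]]]; first exact: entry_lt.
  exists n.+1, t, j, k; split=> //.
  rewrite E -[act1 tbl st i]/(act tbl st [:: i]) act_val // /= !zval_cons.
  by rewrite zval_nil mulg1 !mulgA.
case/pushes_cut=> k -> _; exists 0, st.2, i, k; split=> //.
by rewrite take0 zval_nil mulg1 /sval mulgA mulgK fvals_pushes.
Qed.

End CosetData.

(** * Geodesics near the tree *)

Section Near.
Variables (G : groupType) (Y : seq G).

Definition in_range (v : seq nat) : bool :=
  all (fun j => j < size Y + size Y) v.

(** The ball of radius [k] in the word metric of [Y]; [near k (f^-1 * g)] bounds the distance from
    [f] to [g]. *)
Definition near (k : nat) (g : G) : Prop :=
  exists v, [/\ in_range v, size v <= k & zval Y v = g].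

Lemma letter_symm i : i < size Y + size Y -> letter Y i \in symm Y.
Proof. by move=> lt_i; apply: mem_nth; rewrite size_symm. Qed.

Lemma word_over_letters v : in_range v -> word_over Y [seq letter Y j | j <- v].
Proof.
move=> rv; apply/allP=> _ /mapP [j jv ->]; apply/letter_symm.
exact: (allP rv).
Qed.

Lemma word_over_index (w : seq G) : word_over Y w ->
  exists2 v, in_range v & w = [seq letter Y j | j <- v].
Proof.
move=> ow; exists [seq index x (symm Y) | x <- w].
  apply/allP=> _ /mapP [x /(allP ow) xY ->].
  by rewrite -size_symm index_mem.
rewrite -map_comp map_id_in // => x /(allP ow) xY /=.
by rewrite /letter nth_index.
Qed.

Lemma in_range_cat u v : in_range (u ++ v) = in_range u && in_range v.
Proof. exact: all_cat. Qed.

Lemma in_range_winv v : in_range v -> in_range (winv (size Y) v).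
Proof.
move=> rv; rewrite /in_range /winv all_rev all_map.
apply: sub_all rv => j lt_j /=; rewrite /zinv lt_j.
have [lt_jm|_] := ltnP j (size Y); first by rewrite ltn_add2l.
apply: leq_ltn_trans lt_j; exact: leq_subr.
Qed.

Lemma near_le k l g : k <= l -> near k g -> near l g.
Proof.
by move=> kl [v [rv sv E]]; exists v; split=> //; exact: leq_trans kl.
Qed.

Lemma near1 k : near k 1.
Proof. by exists [::]; split=> //; exact: zval_nil. Qed.

Lemma nearM k l g h : near k g -> near l h -> near (k + l) (g * h).
Proof.
move=> [u [ru su <-]] [v [rv sv <-]]; exists (u ++ v).
by rewrite in_range_cat ru rv size_cat leq_add // zval_cat.
Qed.

Lemma nearV k g : near k g -> near k g^-1.
Proof.
move=> [u [ru su <-]]; exists (winv (size Y) u).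
by rewrite in_range_winv // zval_winv size_rev size_map.
Qed.

Lemma near_chain k l f g h :
  near k (f^-1 * g) -> near l (g^-1 * h) -> near (k + l) (f^-1 * h).
Proof. by move=> /nearM fg /fg; rewrite mulgA mulgK. Qed.

Lemma near_sym k f g : near k (f^-1 * g) -> near k (g^-1 * f).
Proof. by move/nearV; rewrite invgM invgK. Qed.

Lemma in_range_take n v : in_range v -> in_range (take n v).
Proof. by rewrite -{1}(cat_take_drop n v) in_range_cat => /andP []. Qed.

Lemma in_range_drop n v : in_range v -> in_range (drop n v).
Proof. by rewrite -{1}(cat_take_drop n v) in_range_cat => /andP []. Qed.

Lemma near_sub v i j : in_range v -> i <= j ->
  near (j - i) ((zval Y (take i v))^-1 * zval Y (take j v)).
Proof.
move=> rv le_ij; exists (take (j - i) (drop i v)); split.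
- exact/in_range_take/in_range_drop.
- by rewrite size_take_min geq_minl.
by rewrite -(subnKC le_ij) takeD zval_cat mulKg addKn.
Qed.

(** Factors of [v] ending before position [n] are geodesic. For [n = size v] this concerns the
    proper prefixes of [v], for [n = (size v).+1] also [v] itself. *)
Definition progressive (v : seq nat) (n : nat) : Prop :=
  forall i j d, i <= j -> j < n ->
    near d ((zval Y (take i v))^-1 * zval Y (take j v)) -> j <= i + d.

End Near.

(** * Geodesics follow the tree and each other *)

Section Geometry.
Variables (G : groupType) (Z : seq G) (D : free_coset_data Z).
Variables (y : seq (seq nat)) (lam : nat).

Local Notation m := (size Z).
Local Notation tbl := (table D).
Local Notation letters_ok s := (all (fun u : nat * bool => u.1 < nlet D) s).
Local Notation Y := (decode_gens Z y).
Local Notation near := (near Y).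
Local Notation yval := (zval Y).

Lemma size_decode : size Y = size y.
Proof. exact: size_map. Qed.

Lemma zval_spell j : zval Z (spell m y j) = letter Y j.
Proof.
have zvalE w : word_val [seq letter Z i | i <- w] = zval Z w by [].
rewrite /spell /letter /symm !nth_cat size_decode; case: ltnP => [lt_j|le_j].
  by rewrite (nth_map [::]).
have [lt_j|ge_j] := ltnP (j - size y) (size y); last first.
  by rewrite !nth_default ?zval_nil // !size_map.
by rewrite !(nth_map [::], nth_map 1) ?size_map // zval_winv.
Qed.

Lemma zval_spellw v : zval Z (spellw m y v) = yval v.
Proof.
elim: v => [|j v IHv]; first by rewrite !zval_nil.
by rewrite /spellw /= zval_cat -/(spellw m y v) IHv zval_spell zval_cons.
Qed.

Lemma size_spell j : size (spell m y j) <= size (flatten y).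
Proof.
have le_w w : w \in y -> size w <= size (flatten y).
  elim: y => //= w' y' IHy; rewrite inE size_cat => /orP [/eqP ->|/IHy le_w].
    exact: leq_addr.
  exact: leq_trans (leq_addl _ _).
rewrite /spell nth_cat; case: ltnP => [lt_j|le_j].
  by rewrite le_w ?mem_nth.
have [lt_j|ge_j] := ltnP (j - size y) (size y); last first.
  by rewrite nth_default ?size_map.
by rewrite (nth_map [::]) // size_rev size_map le_w ?mem_nth.
Qed.

(** The constants of all estimates: the letters of [Z], the differences found in [act_cut], and
    single steps in the tree. *)
Definition base_near : Prop :=
  [/\ forall i, near lam (letter Z i),
      forall t i k, t < ncos D -> near lam ((cos D t)^-1 *
        fvals (bas D) (rev (take k (table_entry tbl t i).1)))
    & forall u, u.1 < nlet D -> near lam (lval (bas D) u)].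

Hypothesis nearE : base_near.

(** A letter of Y spells at most [size (flatten y)] letters of [Z], each of length at most [lam]
    over Y, and [act_cut] adds one more constant. *)
Local Notation R := (lam * (size (flatten y)).+1)%N.
Local Notation pre v i := (nform tbl (spellw m y (take i v))).

Lemma lam_le_R : lam <= R.
Proof. by rewrite mulnS leq_addr. Qed.

Lemma near_zval w : near (lam * size w) (zval Z w).
Proof.
have [nearZ _ _] := nearE; elim: w => [|i w IHw].
  by rewrite zval_nil; exact: near1.
by rewrite zval_cons mulnS; exact: nearM.
Qed.

Lemma good_pre v i : good D (pre v i).
Proof. exact: good_nform. Qed.

Lemma pre_val v i : sval D (pre v i) = yval (take i v).
Proof. by rewrite nform_val zval_spellw. Qed.

Lemma near_stack st :
  good D st -> near lam ((fvals (bas D) st.1)^-1 * sval D st).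
Proof.
have [_ /(_ st.2 0 0) nearC _] := nearE => /good_lt /nearC.
by rewrite take0 /= mulg1 => /nearV; rewrite invgK /sval mulKg.
Qed.

Lemma spellw_cat u v : spellw m y (u ++ v) = spellw m y u ++ spellw m y v.
Proof. by rewrite /spellw map_cat flatten_cat. Qed.

(** Some single letter of [v] changes whether [a] is a prefix, and [act_cut] applies to its
    spelling. The crossing is located before that letter is read, hence [l < j]. *)
Lemma pre_cross a v i j : i <= j -> j <= size v ->
    suffix a (pre v i).1 != suffix a (pre v j).1 ->
  exists l, [/\ i <= l, l < j
    & near R ((yval (take l v))^-1 * fvals (bas D) a)].
Proof.
move=> le_ij; rewrite -(subnKC le_ij); elim: (j - i)%N => [|d IHd].
  by rewrite addn0 eqxx.
rewrite addnS => lt_s.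
have [E|ne _] :=
    altP (suffix a (pre v (i + d)).1 =P suffix a (pre v (i + d).+1).1).
  rewrite -E => /(IHd (ltnW lt_s)) [l [il ld nl]].
  by exists l; split=> //; exact: leqW.
exists (i + d)%N; split=> //; first exact: leq_addr.
move: ne; rewrite [in X in _ != X](take_nth 0) // -cats1 spellw_cat.
rewrite /nform act_cat -/(nform _ _) /spellw /= cats0 eq_sym.
case/act_cut; first exact/good_lt/good_pre.
move=> n [t [i' [k [lt_t ->]]]]; rewrite pre_val mulgA mulKg.
have [_ nearC _] := nearE; rewrite mulnS addnC.
apply: nearM; last exact: nearC.
apply: near_le (near_zval _); rewrite leq_mul2l; apply/orP; right.
apply: leq_trans (size_spell (nth 0 v (i + d))).
by rewrite size_take_min geq_minr.
Qed.

Lemma pre_reach a v : suffix a (pre v (size v)).1 ->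
  exists2 l, l <= size v & near R ((yval (take l v))^-1 * fvals (bas D) a).
Proof.
case: a => [|u a] sa.
  by exists 0 => //; rewrite take0 zval_nil invg1 mul1g; exact: near1.
have [|l [_ /ltnW ll nl]] :=
    @pre_cross (u :: a) v 0 (size v) (leq0n _) (leqnn _); last by exists l.
by rewrite sa take0 suffixs0.
Qed.

(* [a] is the largest common prefix of the [i]-th and all later normal forms.
   If it is not the whole [i]-th normal form, then the path crosses the next
   vertex on the way to the latter both before and after time [i]; the two
   crossing times are close as the path is geodesic. *)
Lemma pre_common v i :
    in_range Y v -> progressive Y v (size v) -> i <= size v ->
  exists a, [/\ forall j, i <= j -> j <= size v -> suffix a (pre v j).1,
    forall a', (forall j, i <= j -> j <= size v -> suffix a' (pre v j).1) ->
      suffix a' a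
    & near (4 * R) ((fvals (bas D) a)^-1 * yval (take i v))].
Proof.
move=> rv gv le_i.
(* After its last [d] letters are removed, the i-th normal form is a prefix of all later ones; the
   least such [d] gives [a]. *)
pose P d := all (fun j => suffix (drop d (pre v i).1) (pre v j).1)
                (iota i (size v - i).+1).
have PP d : reflect (forall j, i <= j -> j <= size v ->
    suffix (drop d (pre v i).1) (pre v j).1) (P d).
  apply: (iffP allP) => Pd j; last first.
    by rewrite mem_iota addnS subnKC // ltnS => /andP []; exact: Pd.
  by move=> ij jn; apply: Pd; rewrite mem_iota addnS subnKC // ltnS ij.
have exP : exists d, P d.
  by exists (size (pre v i).1); apply/PP=> j _ _; rewrite drop_size suffix0s.
case: (ex_minnP exP) => d /PP Pd mind; exists (drop d (pre v i).1); split=> //.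
  move=> a' Pa'; have /suffixP [s Es] := Pa' i (leqnn _) le_i.
  have /mind le_d : P (size s).
    by apply/PP => j ij jn; rewrite Es drop_size_cat //; exact: Pa'.
  have -> : a' = drop (size s - d) (drop d (pre v i).1).
    by rewrite drop_drop subnK // Es drop_size_cat.
  exact: suffix_drop.
(* If nothing is dropped, only a coset representative separates [a] from v(i). *)
case: d Pd mind => [|d] Pd mind.
  rewrite drop0 -pre_val; apply: near_le (near_stack (good_pre v i)).
  by apply: leq_trans lam_le_R _; rewrite leq_pmull.
have /PP nPd : ~~ P d by apply/negP=> /mind; rewrite ltnn.
have lt_d : d < size (pre v i).1.
  rewrite ltnNge; apply/negP=> ge_d; case: nPd => j _ _.
  by rewrite drop_oversize // suffix0s.
have [u Eu] : exists u, drop d (pre v i).1 = u :: drop d.+1 (pre v i).1.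
  by exists (nth (0, false) (pre v i).1 d); rewrite -drop_nth.
have [j [ij jn nj]] : exists j, [/\ i <= j, j <= size v &
    ~~ suffix (drop d (pre v i).1) (pre v j).1].
  have /allPn [j] : ~~ P d by apply/negP=> /PP.
  by rewrite mem_iota addnS subnKC // ltnS => /andP [ij jn]; exists j.
have sdi := suffix_drop (pre v i).1 d.
(* The vertex one step beyond [a] towards the i-th normal form is a prefix at time i, but neither at
   time 0 nor at time [j]. *)
have [|l1 [_ l1i near1]] :=
    @pre_cross (drop d (pre v i).1) v 0 i (leq0n i) le_i.
  by rewrite sdi take0 Eu suffixs0.
have [|l2 [il2 l2j near2]] := pre_cross ij jn (a := drop d (pre v i).1).
  by rewrite sdi (negbTE nj).
have le_l : l2 <= l1 + (R + R).
  apply: gv; first exact: leq_trans (ltnW l1i) il2.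
    exact: leq_trans l2j jn.
  exact: near_chain near1 (near_sym near2).
have near_i : near (R + R) ((yval (take l1 v))^-1 * yval (take i v)).
  apply: near_le (near_sub rv (ltnW l1i)).
  by rewrite leq_subLR; exact: leq_trans le_l.
have near_d := near_chain (near_sym near1) near_i.
move: near_d; rewrite Eu /= => near_d.
have lt_u : u.1 < nlet D.
  have /and3P [_ /allP lu _] := good_pre v i; apply: lu.
  by apply: (@mem_drop d); rewrite Eu mem_head.
have [_ _ /(_ u lt_u) near_u] := nearE.
(* The tree edge and the first crossing cost at most R each, and the way along [v] from [l1] to [i]
   costs 2R. *)
have := nearM near_u near_d; rewrite invgM -mulgA mulVKg.
apply: near_le; apply: leq_trans (leq_add lam_le_R (leqnn _)) _.
by rewrite !mulSn mul0n addn0 !addnA.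
Qed.

(** a(i) is a prefix of the common normal form, so [w] passes within R of it at some time l, and
    v(i), w(l) are 5R apart. As both prefixes are geodesic, i and l differ by at most 5R, whence
    10R. *)
Lemma fellow_travel v w i :
    in_range Y v -> progressive Y v (size v) ->
    in_range Y w -> progressive Y w (size w).+1 ->
    yval w = yval v -> i <= size v ->
  near (10 * R) ((yval (take i v))^-1 * yval (take i w)).
Proof.
move=> rv gv rw gw E le_i.
(* At the end of [v] its hypothesis, which concerns proper prefixes, says nothing; but by then [w]
   is read completely, being no longer than [v]. *)
have [lt_i|ge_i] := ltnP i (size v); last first.
  have Ei : i = size v by apply/eqP; rewrite eqn_leq le_i.
  have Ew : size w <= size v.
    rewrite -[size v]add0n; apply: gw => //.
    rewrite take0 zval_nil invg1 mul1g take_size E.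
    by exists v.
  by rewrite Ei take_size take_oversize // E mulVg; exact: near1.
have [a [Sa _ near_a]] := pre_common rv gv le_i.
have [|l le_l near_l] := @pre_reach a w.
  rewrite take_size; have -> : nform tbl (spellw m y w) = pre v (size v).
    by apply/eqP/nform_eqP; rewrite !zval_spellw take_size.
  exact: Sa.
have near_il := near_chain (near_sym near_a) (near_sym near_l).
have near0 u k : in_range Y u -> near k (yval (take k u)).
  move=> ru; exists (take k u); split=> //; first exact: in_range_take.
  by rewrite size_take_min geq_minl.
have le_il : i <= l + (4 * R + R).
  rewrite -[i]addn0 -[X in _ <= X]add0n addn0; apply: gv => //.
  rewrite take0 zval_nil invg1 mul1g.
  have := nearM (near0 w l rw) (near_sym near_il).
  by rewrite mulVKg.
have le_li : l <= i + (4 * R + R).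
  rewrite -[X in _ <= X]add0n; apply: gw => //.
  rewrite take0 zval_nil invg1 mul1g.
  have := nearM (near0 v i rv) near_il.
  by rewrite mulVKg.
have near_li : near (4 * R + R) ((yval (take l w))^-1 * yval (take i w)).
  have [le|/ltnW ge] := leqP l i.
    by apply: near_le (near_sub rw le); rewrite leq_subLR.
  by apply/near_sym; apply: near_le (near_sub rw ge); rewrite leq_subLR.
apply: near_le (near_chain near_il near_li).
by rewrite -!mulSnr -mulnDl.
Qed.

End Geometry.

(** * Saturated automata *)

Section Benois.
Variables (G : groupType) (Z : seq G) (D : free_coset_data Z).
Variables (x : seq (seq nat)) (M : den nfaT).

Local Notation m := (size Z).
Local Notation tbl := (table D).
Local Notation letters_ok s := (all (fun u : nat * bool => u.1 < nlet D) s).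
Local Notation X := (decode_gens Z x).

Fixpoint mpath (p : nat) (w : seq nat) (p' : nat) : Prop :=
  if w is i :: w' then exists2 q, (p, i, q) \in M.2 & mpath q w' p'
  else p = p'.

Lemma mpath_cat p u v p' :
  mpath p (u ++ v) p' <-> exists2 q, mpath p u q & mpath q v p'.
Proof.
elim: u p => [|i u IHu] p /=.
  by split=> [uv|[q ->]] //; exists p.
split=> [[q e /IHu [r uq vr]]|[r [q e uq] vr]].
  by exists r => //; exists q.
by exists q => //; apply/IHu; exists r.
Qed.

Lemma accepts_decode u : accepts (decode_nfa X M) u <->
  exists p w p', [/\ p \in M.1.1, p' \in M.1.2, mpath p w p'
    & u = [seq letter X i | i <- w]].
Proof.
have acc p : accepts_from (decode_nfa X M) p u <-> exists w p',
    [/\ p' \in M.1.2, mpath p w p' & u = [seq letter X i | i <- w]].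
  elim: u p => [|g u IHu] p /=; split.
  - by move=> Fp; exists [::], p.
  - by move=> [[|i w] [p' [Fp /= E]]] // _; rewrite E.
  - move=> [q /mapP [[[p1 i] q1] e [-> -> ->]] /IHu [w [p' [Fp pw ->]]]].
    by exists (i :: w), p'; split=> //; exists q1.
  move=> [[|i w] [p' [Fp pw]]] //= [-> Eu]; have [q e qw] := pw.
  exists q; first by apply/mapP; exists (p, i, q).
  by apply/IHu; exists w, p'.
split=> [[p Ip /acc [w [p' [Fp pw E]]]]|[p [w [p' [Ip Fp pw E]]]]].
  by exists p, w, p'.
by exists p => //; apply/acc; exists w, p'.
Qed.

Local Notation Q := (astates m (ncos D) tbl x M).
Local Notation T := (benois m (ncos D) (nlet D) tbl x M).
Local Notation run t e := (run_edge m tbl x t e).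

Definition aval (q : astate) : G := fvals (bas D) (rev q.1.1) * cos D q.2.

Lemma mem_labels l : l \in labels (nlet D) = (size l <= 1) && letters_ok l.
Proof.
rewrite mem_cat inE; case: l => [|[i b] l]; first by rewrite orbT.
rewrite orbF; apply/allpairsP/idP => [[[j c] [/= + _ [-> _ ->]]]|].
  by rewrite mem_iota /= andbT.
case: l => //=; rewrite andbT => lt_i; exists (i, b).
by split=> //; [rewrite mem_iota|case: b].
Qed.

Lemma mem_triples c :
  c \in triples (nlet D) Q =
  [&& c.1.1 \in Q, size c.1.2 <= 1, letters_ok c.1.2 & c.2 \in Q].
Proof.
case: c => [[q l] q'] /=.
rewrite [X in _ && X]andbA -mem_labels.
apply/allpairsP/and3P => [[[ql q1] /= [qlP q1Q [E ->]]]|[qQ lL q'Q]].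
  by move: qlP; rewrite -E => /allpairsP [[q2 l2] /= [q2Q l2L [-> ->]]].
by exists ((q, l), q'); split=> //=; apply/allpairsP; exists (q, l).
Qed.

Lemma astatesP q : q \in Q -> q.2 < ncos D /\ letters_ok q.1.1.
Proof.
rewrite mem_cat => /orP [/allpairsP [[p t] /= [_ + ->]]|].
  by rewrite mem_iota.
case/flattenP=> s /mapP [[e t] /= /allpairsP [[e1 t1] /= [_ + [-> ->]]] ->].
rewrite mem_iota => /= lt_t /mapP [k _ ->] /=; split; first exact: act_lt.
have : letters_ok (rev (run t1 e1).1) by rewrite all_rev; exact: act_letters.
by rewrite -{1}(cat_take_drop k (rev _)) all_cat => /andP [].
Qed.

Lemma astates_init p t : p \in M.1.1 -> t < ncos D -> ([::], p, t) \in Q.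
Proof.
move=> Ip lt_t; rewrite mem_cat; apply/orP; left.
by apply/allpairsP; exists (p, t); rewrite mem_iota.
Qed.

Lemma astates_run e t k : e \in M.2 -> t < ncos D ->
  (drop k (rev (run t e).1), e.2, (run t e).2) \in Q.
Proof.
move=> eM lt_t; rewrite mem_cat; apply/orP; right; apply/flattenP.
exists [seq (drop j (rev (run t e).1), e.2, (run t e).2)
       | j <- iota 0 (size (run t e).1 + 1)].
  apply/mapP; exists (e, t) => //; apply/allpairsP.
  by exists (e, t); rewrite mem_iota.
have [le_k|/ltnW ge_k] := leqP k (size (run t e).1).
  by apply/mapP; exists k; rewrite ?mem_iota ?addn1 ?ltnS.
apply/mapP; exists (size (run t e).1).
  by rewrite mem_iota addn1 ltnS leqnn.
by rewrite !drop_oversize ?size_rev.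
Qed.

Lemma astates_drop u s p t : (u :: s, p, t) \in Q -> (s, p, t) \in Q.
Proof.
rewrite mem_cat => /orP [/allpairsP [[p1 t1] /= [_ _]] //|].
case/flattenP=> r /mapP [[e t1] /= /allpairsP [[e1 t2] /= [eM + [-> ->]]] ->].
rewrite mem_iota => /= lt_t /mapP [k _ [E -> ->]].
have -> : s = drop k.+1 (rev (run t2 e1).1).
  by rewrite -add1n -drop_drop -E /= drop0.
exact: astates_run.
Qed.

Lemma triples_benois c : c \in T -> c \in triples (nlet D) Q.
Proof. by move: c; apply: (@saturate_ind _ _ _ (fun c => c \in _)) => S. Qed.

(** Here [aval] is the value still owed by a state: its remainder times its coset representative. *)
Definition sound_step (q : astate) (s : stack) (q' : astate) : Prop :=
  exists2 w, mpath q.1.2 w q'.1.2 &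
    aval q * zval X w = fvals (bas D) s * aval q'.

Lemma benois_sound c : c \in T -> sound_step c.1.1 c.1.2 c.2.
Proof.
(* The length bound is carried along because labels are words and stacks are reversed words; for at
   most one letter the two agree. *)
suff: {in T, forall c, size c.1.2 <= 1 /\ sound_step c.1.1 c.1.2 c.2}.
  by move=> H /H [].
apply: saturate_ind => S [[[[r p] t] l] [[r' p'] t']] IHS.
rewrite mem_triples orbC => /and4P [/= qQ sl _ _] rule_l; split=> //.
have revl (s : stack) : size s <= 1 -> rev s = s by case: s => [|u []].
case/orP: rule_l => [/hasP [[[q1 l1] q1'] c1S /hasP [[[q2 l2] q2'] c2S] /=]|].
  case/and4P=> /eqP E1 /eqP E /eqP E2 /eqP El; subst q1 q1' q2' l.
  have [_ [w1 p1 v1]] := IHS _ c1S; have [sl2 [w2 p2 v2]] := IHS _ c2S.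
  exists (w1 ++ w2); first by apply/mpath_cat; exists q2.1.2.
  rewrite zval_cat mulgA [aval _ * _]v1 -mulgA [aval _ * _]v2 mulgA.
  by rewrite fvals_pushes revl.
case/orP=> /and3P [/= /eqP Er /eqP Ep].
  move=> /eqP Et.
  exists [::]; rewrite //= zval_nil mulg1 /aval /= Er Et.
  by rewrite rev_cat fvals_cat -mulgA (revl _ sl) mulgA.
case/hasP=> [[[p1 i] p1'] eM /= /and3P [/eqP <- /eqP <- /eqP E]].
have [lt_t _] := astatesP qQ; exists [:: i] => /=; first by exists p1'.
have := act_val (spell m x i) (st := ([::], t)) lt_t.
rewrite -[act _ _ _]/(run t (p1, i, p1')) E /aval Er Ep /= !mul1g zval_spell.
by rewrite /sval /= mul1g zval_cons zval_nil mulg1.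
Qed.

Local Notation reads := (reads T Q).

Lemma reads_sound q s q' : q' \in reads q s -> sound_step q s q'.
Proof.
elim: s q' => [|u s IHs] q' /=; rewrite mem_filter => /andP [+ _].
  by move/benois_sound.
case/hasP=> q1 /IHs [w1 p1 v1] /benois_sound [w2 p2 v2].
exists (w1 ++ w2); first by apply/mpath_cat; exists q1.1.2.
by rewrite zval_cat mulgA v1 -mulgA v2 /= mul1g mulgA.
Qed.

Lemma rule_mono S S' c : {subset S <= S'} ->
  base_triple m tbl x M c || join_triple S c ->
  base_triple m tbl x M c || join_triple S' c.
Proof.
move=> SS' /orP [-> //|/hasP [c1 c1S /hasP [c2 c2S E]]]; apply/orP; right.
by apply/hasP; exists c1; [exact: SS'|apply/hasP; exists c2; [exact: SS'|]].
Qed.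

Lemma benois_base c :
  c \in triples (nlet D) Q -> base_triple m tbl x M c -> c \in T.
Proof.
by move=> cU bc; apply: (saturate_closed rule_mono) => //; rewrite bc.
Qed.

Lemma benois_join q l1 q1 l2 q' : (q, l1, q1) \in T -> (q1, l2, q') \in T ->
  size (foldl push l1 l2) <= 1 -> (q, foldl push l1 l2, q') \in T.
Proof.
move=> T1 T2 sl; apply: (saturate_closed rule_mono).
  move: (triples_benois T1) (triples_benois T2).
  rewrite !mem_triples /= sl => /and4P [-> _ l1_ok _] /and4P [_ _ l2_ok ->].
  by rewrite pushes_letters.
apply/orP; right; apply/hasP; exists (q, l1, q1) => //.
by apply/hasP; exists (q1, l2, q') => //=; rewrite !eqxx.
Qed.

Lemma benois_refl q : q \in Q -> (q, [::], q) \in T.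
Proof.
move=> qQ; apply: benois_base; first by rewrite mem_triples /= qQ.
by rewrite /base_triple /= !eqxx.
Qed.

Lemma reads_Q q s q' : q' \in reads q s -> q' \in Q.
Proof. by case: s => [|u s] /=; rewrite mem_filter => /andP []. Qed.

Lemma benois_Q q l q' : (q, l, q') \in T -> q' \in Q.
Proof. by move/triples_benois; rewrite mem_triples => /and4P []. Qed.

Lemma reads_refl q : q \in Q -> q \in reads q [::].
Proof. by move=> qQ; rewrite /= mem_filter benois_refl. Qed.

Lemma reads_eps q s q1 q' :
  q1 \in reads q s -> (q1, [::], q') \in T -> q' \in reads q s.
Proof.
move=> + T2; case: s => [|u s] /=; rewrite !mem_filter (benois_Q T2) andbT.
  by case/andP=> T1 _; exact: (benois_join T1 T2).
case/andP=> /hasP [q2 q2s T1] _; apply/hasP; exists q2 => //.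
exact: (benois_join T1 T2).
Qed.

(** If [u] cancels the last letter, saturation has composed the two steps into a silent one, which
    the preceding steps absorb. *)
Lemma reads_push q s q1 u q' :
  q1 \in reads q s -> (q1, [:: u], q') \in T -> q' \in reads q (push s u).
Proof.
move=> + T2; rewrite /push head_push; case: s => [|v s] q1s.
  by rewrite /= mem_filter (benois_Q T2) andbT; apply/hasP; exists q1.
case: eqP => [Ev|_]; last first.
  rewrite [reads _ _]/= mem_filter (benois_Q T2) andbT.
  by apply/hasP; exists q1.
move: q1s; rewrite /= mem_filter => /andP [/hasP [q2 q2s T1] _].
apply: reads_eps q2s _; have := benois_join T1 T2.
by rewrite /= /push /= Ev eqxx; apply.
Qed.

Lemma reads_rest q s r p t : (r, p, t) \in reads q s ->
  ([::], p, t) \in reads q (foldl push s r).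
Proof.
elim: r s => [|u r IHr] s //= urs.
have uQ := reads_Q urs; have [_ /= /andP [lt_u _]] := astatesP uQ.
apply: IHr; apply: reads_push urs _.
apply: benois_base; last by rewrite /base_triple /= !eqxx.
by rewrite mem_triples /= uQ lt_u (astates_drop uQ).
Qed.

Lemma reads_edge q s p t i p' : ([::], p, t) \in reads q s ->
    (p, i, p') \in M.2 ->
  ([::], p', (act tbl ([::], t) (spell m x i)).2) \in
    reads q (foldl push s (rev (act tbl ([::], t) (spell m x i)).1)).
Proof.
move=> rs eM; have pQ := reads_Q rs.
apply: reads_rest; apply: reads_eps rs _; have [/= lt_t _] := astatesP pQ.
apply: benois_base.
  by rewrite mem_triples /= pQ -[rev _]drop0 (astates_run 0 eM).
apply/orP; right; apply/and3P; split=> //=.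
apply/hasP; exists (p, i, p') => //=.
by rewrite !eqxx revK /run_edge; case: act => s' t' /=; rewrite eqxx.
Qed.

Lemma reads_path q st p w p' :
    ([::], p, st.2) \in reads q st.1 -> good D st -> mpath p w p' ->
  exists st', [/\ good D st', sval D st' = sval D st * zval X w
    & ([::], p', st'.2) \in reads q st'.1].
Proof.
elim: w p st => [|i w IHw] p st rs gst /=.
  by move=> <-; exists st; rewrite zval_nil mulg1.
case=> p1 e pw; have := reads_edge rs e; set a := act _ _ _ => rs'.
have lt_t := good_lt gst; case/and3P: gst => red_s ls ct.
have ga : good D a by apply: good_act; rewrite /good ct.
have [|||st' [gst' v rst']] := IHw p1 (foldl push st.1 (rev a.1), a.2) => //.
  case/and3P: ga => _ la ca; apply/and3P; split=> //=.
    exact: pushes_reduced.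
  by apply: pushes_letters; rewrite ?all_rev.
exists st'; split=> //; rewrite v zval_cons mulgA; congr (_ * _).
rewrite /sval fvals_pushes revK -!mulgA; congr (_ * _).
by rewrite -[LHS]/(sval D a) act_val // /sval /= mul1g zval_spell.
Qed.

Lemma reads_cat q a b q' : q \in Q -> q' \in reads q (b ++ a) ->
  exists2 q1, q1 \in reads q a & q' \in reads q1 b.
Proof.
move=> qQ; elim: b q' => [|u b IHb] q' /=.
  by move=> qa; exists q'; rewrite // reads_refl // (reads_Q qa).
rewrite mem_filter => /andP [/hasP [q2 /IHb [q1 q1a q2b] T2] q'Q].
by exists q1 => //; rewrite mem_filter q'Q andbT; apply/hasP; exists q2.
Qed.

End Benois.

(** * The automaton of geodesics *)

Section Assemble.
Variables (sts : seq gstate) (init : seq nat) (fin : seq gstate).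
Variable edges : seq (gstate * nat * gstate).
Hypothesis fin_sts : {subset fin <= sts}.
Hypothesis edges_sts :
  forall e, e \in edges -> (e.1.1 \in sts) && (e.2 \in sts).

Local Notation N := (assemble sts init fin edges).

Fixpoint gacc (c : gstate) (w : seq nat) : Prop :=
  if w is j :: w' then exists2 c', (c, j, c') \in edges & gacc c' w'
  else c \in fin.

Lemma index_sts_inj c c' : c \in sts -> c' \in sts ->
  index c sts = index c' sts -> c = c'.
Proof. by move=> cS c'S E; rewrite -(nth_index c cS) E nth_index. Qed.

Lemma assemble_path c w : c \in sts ->
  (exists2 p', mpath N (index c sts) w p' & p' \in N.1.2) <-> gacc c w.
Proof.
elim: w c => [|j w IHw] c cS /=.
  split=> [[_ <- /mapP [c' c'F /index_sts_inj -> //]]|cF]; first exact: fin_sts.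
  by exists (index c sts) => //; exact: map_f.
split=> [[p' [q /mapP [e eE [Ec -> ->]] qw] Fp']|[c' eE c'w]].
  have /andP [e1S e2S] := edges_sts eE; exists e.2.
    by rewrite (index_sts_inj cS e1S Ec) -!surjective_pairing.
  by apply/IHw => //; exists p'.
have /andP [_ c'S] := edges_sts eE.
have [p' c'p Fp'] := (IHw _ c'S).2 c'w; exists p' => //.
by exists (index c' sts) => //; apply/mapP; exists (c, j, c').
Qed.

End Assemble.

(** * Geodesics in terms of letter codes *)

Section Shortest.
Variables (G : groupType) (Y : seq G).

Definition shortest (v : seq nat) : Prop :=
  in_range Y v /\
  forall w, in_range Y w -> zval Y w = zval Y v -> size v <= size w.

Lemma shortest_geodesic v :
  shortest v <-> in_range Y v /\ geodesic Y [seq letter Y j | j <- v].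
Proof.
split=> [[rv sv]|[rv [_ gv]]]; split=> //.
  split; first exact: word_over_letters.
  move=> u /word_over_index [w rw ->] E; rewrite !size_map.
  exact: sv.
move=> w rw E; have := gv _ (word_over_letters rw) E.
by rewrite !size_map.
Qed.

Lemma shortest_exists v : in_range Y v ->
  exists w, [/\ shortest w, zval Y w = zval Y v & size w <= size v].
Proof.
move=> rv; pose P k := boolp.asbool
  (exists w, [/\ in_range Y w, zval Y w = zval Y v & size w = k]).
have exP : exists k, P k by exists (size v); apply/boolp.asboolP; exists v.
case: (ex_minnP exP) => _ /boolp.asboolP [w [rw E <-]] min.
have sw u : in_range Y u -> zval Y u = zval Y v -> size w <= size u.
  by move=> ru Eu; apply: min; apply/boolp.asboolP; exists u.
exists w; split=> //; last exact: sw.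
by split=> // u ru Eu; apply: sw; rewrite // Eu.
Qed.

(** A shorter word put in the place of a factor would shorten [v]. *)
Lemma shortest_progressive v : shortest v -> progressive Y v (size v).+1.
Proof.
move=> [rv sv] i j d le_ij; rewrite ltnS => le_j [u [ru su Eu]].
have := sv (take i v ++ u ++ drop j v).
rewrite !in_range_cat ru in_range_take // in_range_drop //.
rewrite !zval_cat Eu !mulgA mulgV mul1g -zval_cat cat_take_drop.
move=> /(_ isT erefl); rewrite !size_cat size_drop size_takel; last first.
  exact: leq_trans le_j.
rewrite -{1}(subnK le_j) addnA [X in _ <= X]addnC leq_add2l => le_su.
by apply: leq_trans le_su _; rewrite leq_add2l.
Qed.

End Shortest.

(** * Soundness and completeness of the automaton *)

Section Automaton.
Variables (G : groupType) (Z : seq G) (D : free_coset_data Z).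
Variables (x y : seq (seq nat)) (M : den nfaT) (lam : nat).

Local Notation m := (size Z).
Local Notation tbl := (table D).
Local Notation X := (decode_gens Z x).
Local Notation Y := (decode_gens Z y).
Local Notation yval := (zval Y).
Local Notation k := (radius y lam).
Local Notation W := (words (nsymm y) k).
Local Notation U := (marks W).
Local Notation Q := (astates m (ncos D) tbl x M).
Local Notation T := (benois m (ncos D) (nlet D) tbl x M).
Local Notation reads := (reads T Q).
Local Notation sts := (gstates Q W).
Local Notation N := (geo_nfa m (ncos D) (nlet D) tbl (x, (y, M), lam)).
Local Notation edge := (geo_edge m tbl y U (T, Q)).
Local Notation step := (marks_step m tbl y U).
Local Notation over := (overtaken m tbl y).
Local Notation S0 := [:: ([::] : seq nat, false)].
Local Notation fin := [seq c <- sts | geo_final m tbl y M.1.2 (T, Q) c].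
Local Notation edges := [seq c <- [seq (cj, c') |
  cj <- [seq (c, j) | c <- sts, j <- iota 0 (nsymm y)], c' <- sts] | edge c].
Local Notation near := (near Y).
Local Notation pre v i := (nform tbl (spellw m y (take i v))).

Lemma mem_W v : v \in W = in_range Y v && (size v <= k).
Proof. by rewrite mem_words /nsymm -(size_decode Z y). Qed.

Lemma near_W g : near k g -> exists2 v, v \in W & yval v = g.
Proof. by case=> v [rv sv E]; exists v; rewrite ?mem_W ?rv. Qed.

Lemma mem_gstates q v S :
  (q, v, S) \in sts = [&& q \in Q, v \in W & S \in subseqs U].
Proof.
apply/allpairsP/and3P => [[[qv S'] /= [+ SU [E ->]]]|[qQ vW SU]].
  by rewrite -E => /allpairsP [[q1 v1] /= [q1Q v1W [-> ->]]].
by exists ((q, v), S); split=> //; apply/allpairsP; exists (q, v).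
Qed.

Lemma mem_edges c j c' : (c, j, c') \in edges =
  [&& edge (c, j, c'), c \in sts, j < nsymm y & c' \in sts].
Proof.
rewrite mem_filter; congr (_ && _).
apply/allpairsP/and3P => [[[cj c1] /= [+ c1S [E ->]]]|[cS lt_j c'S]].
  by rewrite -E => /allpairsP [[c2 j2] /= [c2S + [-> ->]]]; rewrite mem_iota.
exists ((c, j), c'); split=> //; apply/allpairsP; exists (c, j).
by rewrite mem_iota.
Qed.

Lemma fin_sts : {subset fin <= sts}.
Proof. by move=> c; rewrite mem_filter => /andP []. Qed.

Lemma edges_sts e : e \in edges -> (e.1.1 \in sts) && (e.2 \in sts).
Proof. by case: e => [[c j] c']; rewrite mem_edges => /and4P [_ -> _ ->]. Qed.

Definition unbeaten (S : seq marked) (v : seq nat) : Prop :=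
  forall i, i < size v -> ~~ over (foldl step S (take i.+1 v)).

Lemma unbeaten_cons S j v :
  unbeaten S (j :: v) <-> ~~ over (step S j) /\ unbeaten (step S j) v.
Proof.
split=> [Uv|[US Uv] [|i] lt_i /=]; last 2 first.
- by rewrite take0.
- exact: Uv.
split=> [|i lt_i]; first by have := Uv 0 isT; rewrite /= take0.
exact: (Uv i.+1).
Qed.

Lemma in_rangeE v : in_range Y v = all (fun j => j < nsymm y) v.
Proof. by rewrite /in_range (size_decode Z y). Qed.

(** The words read in the tree telescope: an edge with letter j contributes v j v'^-1, so that only
    the first stored word and the input remain. *)
Lemma gacc_sound q v S u : gacc fin edges (q, v, S) u ->
  [/\ in_range Y u, unbeaten S u & exists w p', [/\ mpath M q.1.2 w p',
    p' \in M.1.2 & aval D q * zval X w = yval v * yval u]].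
Proof.
elim: u q v S => [|j u IHu] q v S /=.
  rewrite mem_filter => /andP [/hasP [p' Fp' /reads_sound [w pw E]] _].
  split=> //; exists w, p'; split=> //.
  rewrite E /= [zval _ [::]]zval_nil mulg1.
  rewrite /aval /= mul1g -[LHS]/(sval D (nform tbl (spellw m y v))).
  by rewrite nform_val zval_spellw.
case=> [[[q' v'] S']]; rewrite mem_edges => /and4P [+ _ lt_j _].
rewrite /geo_edge /readable /= => /and3P [/andP [/eqP t0 rq] /eqP -> nover].
case/IHu=> ru Uu [w [p' [pw Fp' E]]]; split.
- by apply/andP; rewrite [X in X + X](size_decode Z y).
- exact/unbeaten_cons.
have [w0 pw0 E0] := reads_sound rq; exists (w0 ++ w), p'; split=> //.
  by apply/mpath_cat; exists q'.1.2.
set w1 := (spellw m y v ++ _) in t0 rq E0; have := nform_val D w1.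
rewrite /sval t0 cos0 mulg1 !zval_cat zval_winv zval_spell !zval_spellw => Est.
rewrite mulgA E0 -mulgA E Est zval_cons.
by rewrite -!mulgA mulKg.
Qed.

(** Replaying the steps rebuilds a competitor: it is extended by a letter in the first case of
    [mark_step] and left alone in the second. *)
Lemma marks_sound u c : c \in foldl step S0 u ->
  exists w, [/\ in_range Y w, yval w = yval u * yval c.1, size w <= size u
    & c.2 -> size w < size u].
Proof.
elim/last_ind: u c => [|u j IHu] c.
  by rewrite inE => /eqP -> /=; exists [::]; rewrite zval_nil mulg1.
rewrite -cats1 foldl_cat /= mem_filter => /andP [/hasP [d /IHu]].
move=> [w [rw Ew le_w lt_w]] + _.
rewrite zval_cat size_cat addn1 zval_cons zval_nil mulg1 /mark_step.
case/orP=> [/andP [/hasP [i + /nform_eqP E] /eqP cd]|/andP [/nform_eqP E c2]].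
  rewrite mem_iota => /= lt_i; exists (w ++ [:: i]).
  rewrite in_range_cat rw zval_cat Ew size_cat addn1 ltnS /= -cd; split=> //.
    by rewrite /in_range /= andbT (size_decode Z y).
  move: E; rewrite !zval_cat zval_winv zval_spell !zval_spellw zval_spell => <-.
  by rewrite zval_cons zval_nil mulg1 !mulgA mulgK.
exists w; split=> //; last exact: leqW.
move: E; rewrite zval_cat zval_winv zval_spell !zval_spellw => <-.
by rewrite -!mulgA mulVKg.
Qed.

Lemma overP S : reflect (exists2 c, c \in S & c.2 && (yval c.1 == 1)) (over S).
Proof.
have E c : (nform tbl (spellw m y c.1) == ([::], 0)) = (yval c.1 == 1) :> bool.
  rewrite -[([::], 0)]/(nform tbl [::]) -zval_spellw.
  by apply/nform_eqP/eqP; rewrite zval_nil.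
by apply: (iffP hasP) => [[c cS oc]|[c cS oc]]; exists c; rewrite // (E, =^~ E).
Qed.

Lemma shortest_unbeaten v : shortest Y v -> unbeaten S0 v.
Proof.
move=> [rv sv] i lt_i; apply/negP=> /overP [c /marks_sound].
move=> [w [rw Ew _ lt_w]] /andP [/lt_w {}lt_w /eqP c1].
have := sv (w ++ drop i.+1 v); rewrite in_range_cat rw in_range_drop //.
rewrite zval_cat Ew c1 mulg1 -zval_cat cat_take_drop => /(_ isT erefl).
apply/negP; rewrite -ltnNge -{2}(cat_take_drop i.+1 v) !size_cat.
by rewrite ltn_add2r.
Qed.

Lemma in_range_rcons v j :
  in_range Y (rcons v j) = in_range Y v && (j < nsymm y).
Proof. by rewrite !in_rangeE all_rcons andbC. Qed.

Lemma in_range_nth v i : in_range Y v -> i < size v -> nth 0 v i < nsymm y.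
Proof. by rewrite in_rangeE => /allP rv lt_i; apply: rv; exact: mem_nth. Qed.

Hypothesis nearE : base_near D y lam.

(* Compare the first prefix of [v] that is not geodesic with a geodesic [w] for
   the same element: by [fellow_travel] the marked words of [w] stay in [W]. *)
Lemma unbeaten_shortest v : in_range Y v -> unbeaten S0 v -> shortest Y v.
Proof.
elim/last_ind: v => [|u j IHu] rv Uv; first by split.
have /IHu su : in_range Y u by move: rv; rewrite in_range_rcons => /andP [].
have {}su : shortest Y u.
  apply: su => i lt_i; have := Uv i; rewrite size_rcons -cats1 takel_cat //.
  by apply; exact: ltnW.
set v := rcons u j in rv Uv *.
(* A factor of [v] without its last letter is a factor of the geodesic [u]. *)
have prog_v : progressive Y v (size v).
  move=> i l d le_il lt_l.
  have le_l : l <= size u by rewrite -ltnS -(size_rcons u j).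
  rewrite /v -cats1 !takel_cat //; last exact: leq_trans le_l.
  exact: (shortest_progressive su).
split=> // w0 rw0 Ew0; rewrite leqNgt; apply/negP=> lt_w0.
have [w [sw Ew le_w]] := shortest_exists rw0.
have lt_w : size w < size v := leq_ltn_trans le_w lt_w0.
have rw := sw.1; have Ewv : yval w = yval v by rewrite Ew.
(* The competitor is the prefix of [w] of length [i], flagged once [i] exceeds the length of [w]. *)
have mark i : i <= size v -> exists2 c,
    yval c = (yval (take i v))^-1 * yval (take i w)
    & (c, size w < i) \in foldl step S0 (take i v).
  elim: i => [|i IHi] le_i.
    by exists [::]; rewrite !take0 ?zval_nil ?invg1 ?mulg1 // inE.
  have [c Ec cS] := IHi (ltnW le_i).
  have := fellow_travel nearE rv prog_v rw (shortest_progressive sw) Ewv le_i.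
  case/near_W=> c' c'W Ec'; exists c' => //.
  rewrite (take_nth 0 le_i) -cats1 foldl_cat [foldl _ _ [:: _]]/= mem_filter.
  apply/andP; split; last first.
    by apply/allpairsP; exists (c', size w < i.+1); split=> //; case: (_ < _).
  apply/hasP; exists (c, size w < i) => //.
  (* While [w] has letters left it reads one and the flag stays false; once exhausted it waits, and
     the flag is true. *)
  have [lt_i|ge_i] := ltnP i (size w); apply/orP; [left|right].
    rewrite /= ltnNge (ltnW lt_i) ltnS leqNgt lt_i eqxx andbT; apply/hasP.
    exists (nth 0 w i); first by rewrite mem_iota /=; exact: in_range_nth.
    apply/nform_eqP.
    rewrite !zval_cat zval_winv !zval_spell !zval_spellw Ec Ec'.
    rewrite (take_nth 0 le_i) (take_nth 0 lt_i) -!cats1 !zval_cat !zval_cons.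
    by rewrite !zval_nil !mulg1 invgM !mulgA.
  rewrite /= ltnS ge_i andbT; apply/nform_eqP.
  rewrite zval_cat zval_winv zval_spell !zval_spellw Ec Ec'.
  rewrite (take_nth 0 le_i) -!cats1 !zval_cat !zval_cons zval_nil mulg1.
  by rewrite (take_oversize ge_i) (take_oversize (leqW ge_i)) invgM !mulgA.
have [c Ec cS] := mark _ (leqnn _).
have := Uv (size u); rewrite size_rcons => /(_ (leqnn _)); apply/negP/negPn.
rewrite -(size_rcons u j) -/v; apply/overP; exists (c, size w < size v) => //=.
by rewrite lt_w Ec take_size take_oversize 1?ltnW // Ewv mulVg eqxx.
Qed.

Lemma init_sts p : p \in M.1.1 -> ([::], p, 0, [::], S0) \in sts.
Proof.
move=> Ip; have W0 : [::] \in W by rewrite mem_W.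
rewrite mem_gstates W0 astates_init ?(canonical_lt (canonical0 D)) //=.
apply: mem_subseqs; rewrite sub1seq; apply/allpairsP.
by exists ([::], false); split.
Qed.

(** The accepting run reads a(i) in the saturated automaton by time i and stores a word for a(i)^-1
    v(i). *)
Lemma gacc_complete v p w p' : shortest Y v -> p \in M.1.1 -> p' \in M.1.2 ->
    mpath M p w p' -> zval X w = yval v ->
  gacc fin edges ([::], p, 0, [::], S0) v.
Proof.
move=> sv Ip Fp' pw Ew; have rv := sv.1.
have prog_v : progressive Y v (size v).
  by move=> i j d le_ij /leqW; exact: (shortest_progressive sv).
have /boolp.choice [a aP] : forall i, exists a, i <= size v ->
    [/\ forall j, i <= j -> j <= size v -> suffix a (pre v j).1,
    forall a', (forall j, i <= j -> j <= size v -> suffix a' (pre v j).1) ->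
      suffix a' a
    & near (4 * (lam * (size (flatten y)).+1))
        ((fvals (bas D) a)^-1 * yval (take i v))].
  move=> i; have [le_i|_] := leqP i (size v); last by exists [::].
  by have [a aP] := pre_common nearE rv prog_v le_i; exists a.
have q0Q : ([::], p, 0) \in Q.
  by rewrite astates_init ?(canonical_lt (canonical0 D)).
set st := pre v (size v); have gst : good D st by exact: good_nform.
have rst : ([::], p', st.2) \in reads ([::], p, 0) st.1.
  have [st' [gst' Est' rst']] :=
    reads_path (st := ([::], 0)) (reads_refl q0Q) (good0 D) pw.
  suff -> : st = st' by [].
  apply: (good_inj gst gst').
  by rewrite Est' sval0 mul1g Ew /st pre_val take_size.
(* At the last time only one normal form is left, and it is its own largest common prefix. *)
have an : a (size v) = st.1.
  have [le_a sub_a _] := aP _ (leqnn _); have sa := le_a _ (leqnn _) (leqnn _).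
  have /sub_a sa' : forall j, size v <= j -> j <= size v ->
      suffix st.1 (pre v j).1.
    move=> j ge_j le_j; have -> : j = size v by apply/eqP; rewrite eqn_leq le_j.
    exact: suffix_refl.
  case/suffixP: sa sa' => s Es; rewrite Es; case/suffixP=> s' E.
  have := congr1 size E; rewrite !size_cat addnA => /eqP.
  rewrite -[X in X == _]add0n eqn_add2r eq_sym addn_eq0.
  by case/andP=> _ /nilP ->.
(* Induction on the number [n] of letters left: [c] is the part of the final normal form beyond
   a(i), and it is readable from [q]. *)
have complete n i q c S u : n + i = size v -> q \in Q -> S \in subseqs U ->
    c ++ a i = st.1 -> ([::], p', st.2) \in reads q c -> u \in W ->
    yval u = (fvals (bas D) (a i))^-1 * yval (take i v) ->
    unbeaten S (drop i v) -> gacc fin edges (q, u, S) (drop i v).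
  elim: n i q c S u => [|n IHn] i q c S u.
    rewrite add0n => -> qQ SU Ec rc uW Eu _; rewrite drop_size /=.
    rewrite mem_filter mem_gstates qQ uW SU !andbT.
    apply/hasP; exists p' => //=.
    have -> : nform tbl (spellw m y u) = ([::], st.2).
      apply: nform_sval.
        by case/and3P: gst => _ _ ct; rewrite /good /= ct.
      rewrite zval_spellw Eu an -(pre_val D y) -/st /sval mulKg.
      by rewrite /= mul1g.
    have c0 : c = [::] by apply: (@cat_injr _ _ _ st.1); rewrite -{1}an.
    by move: rc; rewrite c0.
  rewrite addSn => Ei qQ SU Ec rc uW Eu Uv.
  have lt_i : i < size v by rewrite -Ei ltnS leq_addl.
  have [le_a _ _] := aP _ (ltnW lt_i); have [le_a' sub_a near_a] := aP _ lt_i.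
  have /suffixP [b Eb] : suffix (a i) (a i.+1).
    by apply: sub_a => j /ltnW; exact: le_a.
  have /suffixP [c' Ec'] : suffix (a i.+1) st.1 by exact: le_a'.
  have Ecb : c = c' ++ b.
    by apply: (@cat_injr _ _ _ (a i)); rewrite -catA -Eb Ec.
  move: rc; rewrite Ecb => /(reads_cat qQ) [q' rq' rc'].
  have [u' u'W Eu'] : exists2 u', u' \in W &
      yval u' = (fvals (bas D) (a i.+1))^-1 * yval (take i.+1 v).
    apply: near_W; apply: near_le near_a; rewrite /radius leq_mul2r.
    by rewrite orbT.
  move: Uv; rewrite (drop_nth 0 lt_i) => /unbeaten_cons [nover Uv].
  set j := nth 0 v i in nover Uv *.
  have S'U : step S j \in subseqs U by apply/mem_subseqs/filter_subseq.
  exists (q', u', step S j); last first.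
    by apply: (IHn _ _ c') => //; rewrite -?Ei ?addnS // (reads_Q rq').
  rewrite mem_edges !mem_gstates qQ uW SU (reads_Q rq') u'W S'U.
  rewrite (in_range_nth rv lt_i) /= !andbT /geo_edge /= eqxx nover andbT.
  rewrite /readable /=; set w1 := (spellw m y u ++ _).
  (* The value u j u'^-1 is that of [b], which is reduced as a factor of the final normal form. *)
  have -> : nform tbl w1 = (b, 0).
    apply: nform_sval.
      case/and3P: gst => rs ls _; rewrite /good /= canonical0 andbT.
      move: rs ls; rewrite Ec' Eb !all_cat /reduced_stack => rs /and3P [_ -> _].
      by rewrite andbT; have [_ /cat_sorted2 []] := cat_sorted2 rs.
    rewrite /w1 !zval_cat zval_winv zval_spell !zval_spellw Eu Eu' Eb fvals_cat.
    rewrite (take_nth 0 lt_i) -cats1 zval_cat zval_cons zval_nil mulg1 -/j.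
    by rewrite /sval /= cos0 mulg1 !invgM !invgK !mulgA !mulgK mulVg mul1g.
  by rewrite eqxx andbT.
have a0 : a 0 = [::].
  have [le_a _ _] := aP 0 (leq0n _); have := le_a _ (leqnn _) (leq0n _).
  by rewrite take0 suffixs0 => /eqP.
rewrite -[v]drop0; apply: (complete (size v) 0 _ st.1) => //.
- by rewrite addn0.
- by have := init_sts Ip; rewrite mem_gstates => /and3P [].
- by rewrite a0 cats0.
- by have := init_sts Ip; rewrite mem_gstates => /and3P [].
- by rewrite a0 take0 !zval_nil invg1 mulg1.
by rewrite drop0; exact: shortest_unbeaten.
Qed.

Lemma nfa_over_geo_nfa : nfa_over Y (decode_nfa Y N).
Proof.
apply/allP => _ /mapP [_ /mapP [[[c j] c'] cE ->] ->] /=.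
apply: letter_symm; move: cE; rewrite mem_edges size_decode.
by case/and4P.
Qed.

Lemma geo_nfa_correct (K : G -> Prop) :
  rational_witness X (decode_nfa X M) K ->
  geo_witness Y (decode_nfa Y N) K.
Proof.
move=> [_ KM]; split; first exact: nfa_over_geo_nfa.
move=> u; split=> [[gu Ku]|].
  have [v rv Eu] := word_over_index gu.1; move: gu Ku; rewrite Eu => gu Ku.
  have sv : shortest Y v by apply/shortest_geodesic.
  have [_ /accepts_decode [p [w [p' [Ip Fp' pw ->]]]] Ew] := (KM _).1 Ku.
  have gv := gacc_complete sv Ip Fp' pw Ew.
  have [q' vq Fq'] :=
    (assemble_path M.1.1 fin_sts edges_sts v (init_sts Ip)).2 gv.
  apply/accepts_decode; exists (index ([::], p, 0, [::], S0) sts), v, q'.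
  by split=> //; apply/mapP; exists p.
case/accepts_decode=> _ [v [q' [/mapP [p Ip ->] Fq' vq ->]]].
have gv := (assemble_path M.1.1 fin_sts edges_sts v (init_sts Ip)).1
  (ex_intro2 _ _ q' vq Fq').
have [rv Uv [w [p' [pw Fp' E]]]] := gacc_sound gv.
have [_ gvY] := (shortest_geodesic Y v).1 (unbeaten_shortest rv Uv).
split=> //; apply/KM; exists [seq letter X i | i <- w].
  by apply/accepts_decode; exists p, w, p'.
by move: E; rewrite /aval /= cos0 !mul1g zval_nil mul1g.
Qed.

End Automaton.

(** * The constants and the search for their bound *)

Section Constants.
Variables (G : groupType) (Z : seq G) (D : free_coset_data Z).
Hypothesis genZ : generating Z.

Lemma zval_surj (Y : seq G) (g : G) : generating Y ->
  exists2 w, in_range Y w & zval Y w = g.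
Proof.
by move=> /(_ g) [_ /word_over_index [w rw ->] <-]; exists w.
Qed.

Lemma zwords_list (s : seq G) : exists E : seq (seq nat), map (zval Z) E = s.
Proof.
elim: s => [|g s [E <-]]; first by exists [::].
by have [w _ <-] := zval_surj g genZ; exists (w :: E).
Qed.

(** The families of [base_near] have finitely many values: letters out of range are 1, lookups
    outside the table give the empty word, and truncation past the end changes nothing. *)
Lemma base_near_constants : exists C : seq G, forall y lam,
  {in C, forall g, near (decode_gens Z y) lam g} -> base_near D y lam.
Proof.
pose C1 := [seq letter Z i | i <- iota 0 (size Z + size Z)].
pose ws t := [::] :: [seq e.1 | e <- nth [::] (table D) t].
pose C2 := flatten [seq [seq (cos D t)^-1 * fvals (bas D) (rev (take k s))
    | s <- ws t, k <- iota 0 (size s).+1] | t <- iota 0 (ncos D)].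
pose C3 := [seq lval (bas D) u
  | u <- [seq (i, b) | i <- iota 0 (nlet D), b <- [:: true; false]]].
exists (C1 ++ C2 ++ C3) => y lam nearC; split.
- move=> i; have [lt_i|ge_i] := ltnP i (size Z + size Z).
    by apply: nearC; rewrite mem_cat map_f // mem_iota.
  by rewrite /letter nth_default ?size_symm //; exact: near1.
- move=> t i k lt_t; apply: nearC; rewrite !mem_cat; apply/orP; right.
  apply/orP; left; apply/flattenP; set s := (table_entry _ _ _).1.
  have sw : s \in ws t.
    rewrite /s /table_entry.
    have [lt_i|ge_i] := ltnP i (size (nth [::] (table D) t)).
      by rewrite inE map_f ?orbT // mem_nth.
    by rewrite nth_default // mem_head.
  exists [seq (cos D t)^-1 * fvals (bas D) (rev (take k s))
    | s <- ws t, k <- iota 0 (size s).+1].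
    by apply: map_f; rewrite mem_iota.
  apply/allpairsPdep; exists s, (minn k (size s)); split=> //.
    by rewrite mem_iota /= ltnS geq_minr.
  congr (_ * fvals _ (rev _)); have [le_k|/ltnW ge_k] := leqP k (size s) => //.
  by rewrite take_size take_oversize.
move=> [i b] lt_i; apply: nearC; rewrite !mem_cat; apply/orP; right.
apply/orP; right; apply: map_f; apply/allpairsP; exists (i, b).
by rewrite mem_iota; split=> //; case: (b).
Qed.

Lemma within_near y k w :
  within (size Z) (table D) y k w -> near (decode_gens Z y) k (zval Z w).
Proof.
case/hasP=> v; rewrite mem_words /nsymm -(size_decode Z y) => /andP [rv sv].
by move/nform_eqP; rewrite zval_spellw => E; exists v.
Qed.

(** This makes the search halt: each constant has a word over a generating set, and a bound persists
    for larger [k]. *)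
Lemma covers_exists y (E : seq (seq nat)) : generating (decode_gens Z y) ->
  exists k, covers (size Z) (table D) E y k.
Proof.
move=> genY; elim: E => [|w E [k Ek]]; first by exists 0.
have [v rv Ev] := zval_surj (zval Z w) genY.
exists (maxn k (size v)); rewrite /covers /=; apply/andP; split.
  apply/hasP; exists v; last by apply/nform_eqP; rewrite zval_spellw.
  rewrite mem_words /nsymm -(size_decode Z y) leq_maxr andbT.
  exact: rv.
apply: sub_all Ek => u /hasP [v' v'W Ev']; apply/hasP; exists v' => //.
move: v'W; rewrite !mem_words => /andP [-> sv']; rewrite leq_max.
by rewrite sv'.
Qed.

End Constants.

Local Notation input := (seq (seq nat) *
  (seq (seq nat) * (seq nat * seq nat * seq (nat * nat * nat))))%type.

(** Programs are specified through [enc], whereas [effective] speaks of bare codes; on these types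
    [enc] is the identity, but only up to [map id]. *)
Lemma enc_input (c : input) : enc c = c :> den (Prod gensT (Prod gensT nfaT)).
Proof.
have map2 (s : seq (seq nat)) : map (map id) s = s.
  by rewrite -[RHS]map_id; apply: eq_map => w; rewrite map_id.
case: c => [x [y [[I F] E]]]; rewrite /enc /= !map2 !map_id.
by congr (_, (_, (_, _))); rewrite -[RHS]map_id; apply: eq_map => [[[p a] q]].
Qed.

Lemma enc_input_nat (c : input * nat) :
  enc c = c :> den (Prod (Prod gensT (Prod gensT nfaT)) Nat).
Proof. by case: c => c n; exact: (congr1 (fun c => (c, n)) (enc_input c)). Qed.

Lemma enc_nfa (M : seq nat * seq nat * seq (nat * nat * nat)) :
  enc M = M :> den nfaT.
Proof.
case: M => [[I F] E]; rewrite /enc /= !map_id.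
by congr (_, _); rewrite -[RHS]map_id; apply: eq_map => [[[p a] q]].
Qed.

(** The coset data and the constants depend on [G] and [Z] alone, so they are built into the
    program, which first searches for [lam]. *)
Lemma rational_to_geo (G : groupType) (Z : seq G) :
  virtually_free G -> generating Z ->
  effective Z (@rational_witness G) (@geo_witness G).
Proof.
move=> vfG genZ; have [D] := free_coset_data_exists Z vfG.
have [C CP] := base_near_constants D; have [E EC] := zwords_list genZ C.
have cov : computable (fun c : input * nat =>
    covers (size Z) (table D) E c.1.2.1 c.2).
  by have covers_inst := computable_covers (size Z) (table D) E; computability.
have [srch srchP] := computable_search cov.
have [build buildP] := computable_geo_nfa (size Z) (ncos D) (nlet D) (table D).
exists (PComp build (PPair (PId _) srch)) => x y M K /= genX genY wit.
have [|lam covl runl] := srchP (x, (y, M)).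
  exact: covers_exists.
exists (geo_nfa (size Z) (ncos D) (nlet D) (table D) (x, (y, M), lam)).
  exists (x, (y, M), lam).
    by split=> //=; move: runl; rewrite enc_input.
  by have := buildP (x, (y, M), lam); rewrite enc_input_nat enc_nfa.
apply: (geo_nfa_correct _ wit); apply: CP => g; rewrite -EC => /mapP [w wE ->].
by apply: within_near; move/allP: covl; apply.
Qed.

(** * Converting witnesses and codes *)

Section Conversions.
Variable G : groupType.
Implicit Types (X Z : seq G) (K : G -> Prop).

Lemma geodesic_exists X (g : G) : generating X ->
  exists2 w, geodesic X w & word_val w = g.
Proof.
move=> genX; have [v rv <-] := zval_surj g genX.
have [w [sw Ew _]] := shortest_exists rv.
exists [seq letter X j | j <- w] => //.
by have [] := (shortest_geodesic X w).1 sw.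
Qed.

Lemma geo_to_rational X M K : generating X ->
  geo_witness X M K -> rational_witness X M K.
Proof.
move=> genX [overM accM]; split=> // g; split=> [Kg|[w /accM [_ Kw] <- //]].
have [w gw Ew] := geodesic_exists g genX.
by exists w => //; apply/accM; split; rewrite // Ew.
Qed.

Lemma decode_gens_surj Z X : generating Z -> exists x, decode_gens Z x = X.
Proof. by move=> genZ; exact: zwords_list. Qed.

Lemma decode_nfa_surj X M : nfa_over X M -> exists M', decode_nfa X M' = M.
Proof.
case: M => SF E overE; exists (map_nfa (fun a => index a (symm X)) (SF, E)).
rewrite /decode_nfa /map_nfa /= -map_comp; congr (_, _).
rewrite -[RHS]map_id; apply/eq_in_map => [[[p a] q]] /(allP overE) /= aX.
by rewrite /letter nth_index.
Qed.

End Conversions.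

Theorem corollary3p13 (G : groupType)
    (fgG : finitely_generated G) (vfG : virtually_free G) :
  (forall K : G -> Prop,
     (rational_subset K <->
        exists X : seq G, generating X /\ rational_language X (Geo X K)) /\
     (rational_subset K <->
        forall X : seq G, generating X -> rational_language X (Geo X K))) /\
  (forall Z : seq G, generating Z ->
     [/\ effective Z (@rational_witness G) (@geo_witness G),
         effective Z (@geo_witness G) (@rational_witness G)
       & effective Z (@geo_witness G) (@geo_witness G)]).
Proof.
have [Z genZ] := fgG; split=> [K|{}Z {}genZ]; last first.
  have [F FP] := rational_to_geo vfG genZ.
  split; exists F => x y M K /= genX genY.
  - exact: FP.
  - move/(geo_to_rational genX)/(FP _ _ _ _ genX genY) => [N runN geoN].
    by exists N => //; exact: geo_to_rational.
  - by move/(geo_to_rational genX)/(FP _ _ _ _ genX genY).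
have [F FP] := rational_to_geo vfG genZ.
(* The given automaton and both generating sets are coded relative to [Z] and passed to the
   algorithm. *)
have all_geo : rational_subset K ->
    forall Y, generating Y -> rational_language Y (Geo Y K).
  move=> [X [genX [L [M [overM accM]] KL]]] Y genY.
  have [x Ex] := decode_gens_surj X genZ.
  have [y Ey] := decode_gens_surj Y genZ.
  have [M' EM] := decode_nfa_surj overM; subst X Y.
  have wit : rational_witness (decode_gens Z x)
      (decode_nfa (decode_gens Z x) M') K.
    rewrite EM; split=> // g; rewrite KL.
    by split=> [[w /accM Mw <-]|[w Mw <-]]; exists w => //; apply/accM.
  have [N _ geoN] := FP _ _ _ _ genX genY wit.
  by exists (decode_nfa (decode_gens Z y) N).
have geo_rat X :
    generating X -> rational_language X (Geo X K) -> rational_subset K.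
  move=> genX [M geoM]; exists X; split=> //; exists (accepts M).
    by exists M; split=> //; exact: geoM.1.
  exact: (geo_to_rational genX geoM).2.
split; split=> [ratK|].
- by exists Z; split=> //; exact: all_geo.
- by case=> X [genX geoX]; exact: geo_rat geoX.
- exact: all_geo.
(* One generating set suffices, and [Z] is one, as [G] is finitely generated. *)
- by move=> geoK; apply: (geo_rat Z) => //; exact: geoK.
Qed.
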